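(* There is a polynomial-time $2$-resource-augmented algorithm for Returning BudgetedDelivery on general graphs.
   Context: BudgetedDelivery: we are given an undirected graph $G=(V,E)$ with non-negative edge weights $w(e)$ (the energy needed to traverse edge $e$ in either direction; traversing a fraction of an edge costs the corresponding fraction of its weight), two vertices $s\neq t$, and $k$ mobile agents, agent $i$ starting at vertex $p_i$ with an energy budget $B_i\ge 0$ bounding its total travelled distance. A message is initially at $s$. An agent can pick up the message at its current location, carry it, and drop it at any location (a vertex or a point inside an edge), where another agent may later pick it up. A schedule is feasible if the message is delivered from $s$ to $t$ and no agent exceeds its budget; in the Returning version each agent must additionally end at its starting position $p_i$ within its budget. For $\gamma>1$, a $\gamma$-resource-augmented algorithm is a polynomial-time algorithm that, given an instance, either correctly answers that no feasible schedule exists (with the original budgets), or outputs a feasible schedule for the modified instance in which every budget is replaced by $\gamma\cdot B_i$. *)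

(* Defs.v *)
(* MathComp, with the real numbers of MathComp-Analysis. *)
From HB Require Import structures.
From mathcomp Require Import all_boot all_order all_algebra.
From mathcomp Require Import reals.

Set Implicit Arguments.
Unset Strict Implicit.
Unset Printing Implicit Defensive.

Import Order.TTheory GRing.Theory Num.Theory.

(** * Random access machine with logarithmic cost

    Structured programs over registers that hold natural numbers of any size.
    A program mentions finitely many arrays, and each array has one register
    per natural number, which is 0 unless it was set. Every access or arithmetic
    operation is charged the bit length of the numbers and addresses it
    handles, so that polynomial time here is polynomial time on a Turing
    machine. Results are appended one number at a time to an output tape. *)

Inductive binop := Add | Sub | Mul | Div.

Definition binop_val (o : binop) : nat -> nat -> nat :=
  match o with Add => addn | Sub => subn | Mul => muln | Div => divn end.

Inductive expr :=
| Cst of nat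
| Get of nat & expr
| Bin of binop & expr & expr.

Inductive cmd :=
| Skip
| Store of nat & expr & expr
| Emit of expr
| Seq of cmd & cmd
| If of expr & cmd & cmd
| While of expr & cmd.

Definition bitlen (n : nat) : nat := (trunc_log 2 n).+1.

Definition memory := nat -> nat -> nat.

Definition set_mem (m : memory) (a i v : nat) : memory :=
  fun b j => if (b == a) && (j == i) then v else m b j.

Fixpoint eval (m : memory) (e : expr) : nat :=
  match e with
  | Cst n => n
  | Get a e1 => m a (eval m e1)
  | Bin o e1 e2 => binop_val o (eval m e1) (eval m e2)
  end.

Fixpoint eval_cost (m : memory) (e : expr) : nat :=
  match e with
  | Cst n => bitlen n
  | Get a e1 => eval_cost m e1 + bitlen (eval m e1) + bitlen (eval m e)
  | Bin o e1 e2 => eval_cost m e1 + eval_cost m e2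
                   + bitlen (eval m e1) + bitlen (eval m e2)
                   + bitlen (eval m e)
  end.

Definition config : Type := (memory * seq nat)%type.

(* [exec c s s' T]: run from the configuration [s], the command [c] halts in
   [s'] at total cost [T]. *)
Inductive exec : cmd -> config -> config -> nat -> Prop :=
| ExecSkip s : exec Skip s s 1
| ExecStore m out a e1 e2 :
    exec (Store a e1 e2) (m, out) (set_mem m a (eval m e1) (eval m e2), out)
         (eval_cost m e1 + eval_cost m e2
          + bitlen (eval m e1) + bitlen (eval m e2))
| ExecEmit m out e :
    exec (Emit e) (m, out) (m, rcons out (eval m e))
         (eval_cost m e + bitlen (eval m e))
| ExecSeq c1 c2 s s' s'' T1 T2 :
    exec c1 s s' T1 -> exec c2 s' s'' T2 -> exec (Seq c1 c2) s s'' (T1 + T2)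
| ExecIfTrue e c1 c2 s s' T :
    eval s.1 e != 0 -> exec c1 s s' T ->
    exec (If e c1 c2) s s' (eval_cost s.1 e + T)
| ExecIfFalse e c1 c2 s s' T :
    eval s.1 e = 0 -> exec c2 s s' T ->
    exec (If e c1 c2) s s' (eval_cost s.1 e + T)
| ExecWhileTrue e c s s' s'' T1 T2 :
    eval s.1 e != 0 -> exec c s s' T1 -> exec (While e c) s' s'' T2 ->
    exec (While e c) s s'' (eval_cost s.1 e + T1 + T2)
| ExecWhileFalse e c s :
    eval s.1 e = 0 -> exec (While e c) s s (eval_cost s.1 e).

(* The input is placed in array 0; the other arrays are initially zero. *)
Definition load (inp : seq nat) : memory :=
  fun a i => if a == 0 then nth 0 inp i else 0.

Definition run (A : cmd) (inp out : seq nat) (T : nat) : Prop :=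
  exists m, exec A (load inp, [::]) (m, out) T.

Definition bitsize (inp : seq nat) : nat := \sum_(x <- inp) bitlen x.

Local Open Scope ring_scope.

(** * Instances of Returning BudgetedDelivery *)

(* Weights and budgets are rational, so that an instance is a finite object.
   [weight] is only meaningful on the edges. *)
Record delivery := Delivery {
  nv : nat;
  adj : rel 'I_nv;
  adj_sym : symmetric adj;
  adj_irr : irreflexive adj;
  weight : 'I_nv -> 'I_nv -> rat;
  weight_sym : forall u v, weight u v = weight v u;
  weight_ge0 : forall u v, adj u v -> 0 <= weight u v;
  src : 'I_nv;
  tgt : 'I_nv;
  src_neq_tgt : src != tgt;
  na : nat;
  start : 'I_na -> 'I_nv;
  budget : 'I_na -> rat;
  budget_ge0 : forall i, 0 <= budget i
}.

(** * Schedules *)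

(* A vertex, or the point strictly inside the edge {u, v}, u < v, that is at
   the fraction x of the edge when going from u to v. *)
Inductive location (n : nat) (R : Type) :=
| AtVertex of 'I_n
| Inside of 'I_n & 'I_n & R.
Arguments AtVertex {n R}.
Arguments Inside {n R}.

(* The point at fraction x of the edge {u, v}, going from u to v. *)
Definition edge_point (n : nat) (R : realType) (u v : 'I_n) (x : R) :
    location n R :=
  if x == 0 then AtVertex u
  else if x == 1 then AtVertex v
  else if (u < v)%N then Inside u v x else Inside v u (1 - x).

(* [Move i u v x y]: agent i walks along the edge {u, v} from the point at
   fraction x to the point at fraction y (fractions counted from u), together
   with the message if it carries it. *)
Inductive action (n k : nat) (F : Type) :=
| Move of 'I_k & 'I_n & 'I_n & F & F
| Pick of 'I_k
| Drop of 'I_k.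
Arguments Move {n k F}.
Arguments Pick {n k F}.
Arguments Drop {n k F}.

Definition map_action (n k : nat) (F F' : Type) (f : F -> F')
    (a : action n k F) : action n k F' :=
  match a with
  | Move i u v x y => Move i u v (f x) (f y)
  | Pick i => Pick i
  | Drop i => Drop i
  end.

Inductive message_pos (n k : nat) (R : Type) :=
| LiesAt of location n R
| CarriedBy of 'I_k.
Arguments LiesAt {n k R}.
Arguments CarriedBy {n k R}.

Record state (n k : nat) (R : Type) := State {
  agent_at : 'I_k -> location n R;
  message : message_pos n k R
}.

Section Schedules.
Variables (R : realType) (I : delivery).

Let act := action (nv I) (na I) R.
Let st := state (nv I) (na I) R.

Definition initial : st :=
  State (fun i => AtVertex (start i)) (LiesAt (AtVertex (src I))).

Definition enabled (s : st) (a : act) : Prop :=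
  match a with
  | Move i u v x y =>
      [/\ adj u v, 0 <= x <= 1, 0 <= y <= 1 & agent_at s i = edge_point u v x]
  | Pick i => message s = LiesAt (agent_at s i)
  | Drop i => message s = CarriedBy i
  end.

Definition next (s : st) (a : act) : st :=
  match a with
  | Move i u v x y =>
      State (fun j => if j == i then edge_point u v y else agent_at s j)
            (message s)
  | Pick i => State (agent_at s) (CarriedBy i)
  | Drop i => State (agent_at s) (LiesAt (agent_at s i))
  end.

Fixpoint legal (s : st) (acts : seq act) : Prop :=
  match acts with
  | [::] => True
  | a :: acts' => enabled s a /\ legal (next s a) acts'
  end.

Definition final (acts : seq act) : st := foldl next initial acts.

Definition action_energy (i : 'I_(na I)) (a : act) : R :=
  match a with
  | Move j u v x y => if j == i then `|y - x| * ratr (weight u v) else 0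
  | _ => 0
  end.

Definition energy (acts : seq act) (i : 'I_(na I)) : R :=
  \sum_(a <- acts) action_energy i a.

Definition feasible (B : 'I_(na I) -> R) (acts : seq act) : Prop :=
  [/\ legal initial acts,
      message (final acts) = LiesAt (AtVertex (tgt I)),
      forall i, energy acts i <= B i &
      forall i, agent_at (final acts) i = AtVertex (start i)].

End Schedules.

(** * Encodings *)

(* Numerator and denominator in lowest terms; only used for q >= 0. *)
Definition encode_rat (q : rat) : seq nat := [:: `|numq q|%N; `|denq q|%N].

(* The numbers of vertices and of agents, s, t, the weighted adjacency matrix
   row by row with 0/0 for the pairs that are not edges, and the starting
   vertex and budget of each agent. *)
Definition encode_instance (I : delivery) : seq nat :=
  [:: nv I; na I; src I : nat; tgt I : nat]
  ++ flatten [seq if adj u v then encode_rat (weight u v) else [:: 0; 0]%N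
             | u <- enum 'I_(nv I), v <- enum 'I_(nv I)]
  ++ flatten [seq (start i : nat) :: encode_rat (budget i)
             | i <- enum 'I_(na I)].

(* In an output schedule, fractions are pairs (numerator, denominator) with a
   positive denominator, not necessarily in lowest terms. *)
Definition frac_val (R : realType) (f : nat * nat) : R := f.1%:R / f.2%:R.

Definition positive_dens (n k : nat) (a : action n k (nat * nat)) : bool :=
  if a is Move _ _ _ x y then (0 < x.2)%N && (0 < y.2)%N else true.

Definition encode_action (n k : nat) (a : action n k (nat * nat)) : seq nat :=
  match a with
  | Move i u v x y =>
      [:: 0%N; i : nat; u : nat; v : nat; x.1; x.2; y.1; y.2]
  | Pick i => [:: 1%N; i : nat]
  | Drop i => [:: 2%N; i : nat]
  end.

Definition encode_schedule (n k : nat) (acts : seq (action n k (nat * nat))) :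
    seq nat := flatten (map (@encode_action n k) acts).

(** * Resource-augmented algorithms *)

(* The output 0 means that no schedule is feasible, and the output 1 is
   followed by a schedule. Infeasibility refers to all schedules with real
   positions. *)
Definition correct_output (R : realType) (gamma : R) (I : delivery)
    (out : seq nat) : Prop :=
  (out = [:: 0%N] /\
     ~ exists acts, @feasible R I (fun i => ratr (budget i)) acts)
  \/
  (exists acts : seq (action (nv I) (na I) (nat * nat)),
     [/\ out = 1%N :: encode_schedule acts,
         all (@positive_dens (nv I) (na I)) acts &
         feasible (fun i => gamma * ratr (budget i))
                  (map (map_action (@frac_val R)) acts)]).

Definition polynomial_time (A : cmd) : Prop :=
  exists a b d : nat, forall I : delivery, exists out T,
    run A (encode_instance I) out T /\
    (T <= a * bitsize (encode_instance I) ^ d + b)%N.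

(* [exec] is deterministic, so both conditions are about the same run. *)
Definition resource_augmented_algorithm (R : realType) (gamma : R) (A : cmd) :
    Prop :=
  polynomial_time A /\
  forall I : delivery, exists out T,
    run A (encode_instance I) out T /\ correct_output gamma I out.

(* Main.v *)
(* An agent that returns home within budget B never gets farther than B/2 from
   home. So in a feasible schedule consecutive carriers of the message are linked,
   in the sense that the balls of radius B/2 about their homes meet; the first
   ball contains s and the last one contains t. Conversely, take a chain of
   distinct linked agents from s to t. Each of them goes to the meeting point with
   its predecessor, brings the message home, takes it to the meeting point with
   its successor and returns, at a cost of at most B/2 for each of the four trips,
   hence 2 B. Links depend only on shortest-path distances between vertices:
   agents i and j are linked iff there are u and v, equal or adjacent, with
   d(p_i, u) <= B_i/2, d(p_j, v) <= B_j/2 and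
   d(p_i, u) + w(u, v) + d(v, p_j) <= (B_i + B_j)/2.
   Both the shortest paths and the chain come from Bellman-Ford tables whose last
   row is followed back down to row 0, so that zero-weight cycles are harmless.
   In the table of agents, hops strictly decrease the number of links still
   needed, so that no agent is used twice.

   All arithmetic is on integers, after multiplication by a common denominator.
   Loops only run over vertices or agents, which bounds the number of steps. *)

Require Import Defs.
From mathcomp Require Import all_boot all_order all_algebra.
From mathcomp Require Import reals zify ring lra.

Set Implicit Arguments.
Unset Strict Implicit.
Unset Printing Implicit Defensive.

Import Order.TTheory GRing.Theory Num.Theory.

(** * Loop programs and their cost *)

(** Three difficulties shape the development. Time is charged by bit length, so a polynomial number
    of steps is not enough: repeated squaring would make registers exponentially long. Programs are
    therefore written in a loop language whose semantics is a total function, and a syntactic check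
    yields the polynomial bound once and for all, apart from correctness. Next, a message may change
    hands inside an edge, where infinitely many points compete; but a shortest way from a home to
    such a point passes through one of the two ends, which turns the meeting of two balls into a
    finite search over vertices. Finally, no list of carriers is extracted from a schedule:
    completeness is an invariant about any set of agents closed under links, and is applied to the
    agents for which the table reports failure. Sending every agent home between receiving and
    passing on makes the distance between its two meeting points irrelevant, and between two visits
    the state reduces to the carrier and the energies spent. *)

(* [PFor x c p] runs [p] with register 0 of array [x] going through the numbers
   below the input number of index [c]. *)
Inductive prog :=
| PSkip
| PStore of nat & expr & expr
| PEmit of expr
| PSeq of prog & prog
| PIf of expr & prog & prog
| PFor of nat & nat & prog.

Definition var (a : nat) : expr := Get a (Cst 0).

Fixpoint compile (p : prog) : cmd :=
  match p with
  | PSkip => Skip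
  | PStore a e1 e2 => Store a e1 e2
  | PEmit e => Emit e
  | PSeq p1 p2 => Seq (compile p1) (compile p2)
  | PIf e p1 p2 => If e (compile p1) (compile p2)
  | PFor x c p1 =>
      Seq (Store x (Cst 0) (Cst 0))
          (While (Bin Defs.Sub (Get 0 (Cst c)) (var x))
             (Seq (compile p1) (Store x (Cst 0) (Bin Add (var x) (Cst 1)))))
  end.

Definition set_counter (x i : nat) (s : config) : config :=
  (set_mem s.1 x 0 i, s.2).

(** Total, because a loop fixes its number of rounds on entry. The compiled [While] rereads the
    bound, which makes no difference under [wf]: array 0 is never written, nor is a counter by its
    own body. *)
Fixpoint sem (p : prog) (s : config) : config :=
  match p with
  | PSkip => s
  | PStore a e1 e2 => (set_mem s.1 a (eval s.1 e1) (eval s.1 e2), s.2)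
  | PEmit e => (s.1, rcons s.2 (eval s.1 e))
  | PSeq p1 p2 => sem p2 (sem p1 s)
  | PIf e p1 p2 => if eval s.1 e != 0 then sem p1 s else sem p2 s
  | PFor x c p1 =>
      iteri (s.1 0 c) (fun i s' => set_counter x i.+1 (sem p1 s'))
            (set_counter x 0 s)
  end.

Fixpoint writes (p : prog) : seq nat :=
  match p with
  | PSkip | PEmit _ => [::]
  | PStore a _ _ => [:: a]
  | PSeq p1 p2 | PIf _ p1 p2 => writes p1 ++ writes p2
  | PFor x _ p1 => x :: writes p1
  end.

Fixpoint emits (p : prog) : bool :=
  match p with
  | PSkip | PStore _ _ _ => false
  | PEmit _ => true
  | PSeq p1 p2 | PIf _ p1 p2 => emits p1 || emits p2
  | PFor _ _ p1 => emits p1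
  end.

(* The right factor of a product must be a constant or an input number, so that
   a single step lengthens the numbers in memory by O(input length) bits: the
   cost of a program is then polynomial in its number of steps. *)
Fixpoint tame (e : expr) : bool :=
  match e with
  | Cst _ => true
  | Get _ e1 => tame e1
  | Bin Mul e1 e2 =>
      [&& tame e1, tame e2
        & match e2 with Cst _ | Get 0 _ => true | _ => false end]
  | Bin _ e1 e2 => tame e1 && tame e2
  end.

Fixpoint wf (p : prog) : bool :=
  match p with
  | PSkip => true
  | PStore a e1 e2 => [&& a != 0, tame e1 & tame e2]
  | PEmit e => tame e
  | PSeq p1 p2 => wf p1 && wf p2
  | PIf e p1 p2 => [&& tame e, wf p1 & wf p2]
  | PFor x c p1 => [&& x != 0, c < 2, x \notin writes p1 & wf p1]
  end.

Lemma sem_frame p a i s : a \notin writes p -> (sem p s).1 a i = s.1 a i.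
Proof.
elim: p s => //=.
- by move=> b e1 e2 s; rewrite inE /set_mem => /negPf->.
- by move=> p1 IH1 p2 IH2 s; rewrite mem_cat negb_or => /andP[h1 h2]; rewrite IH2 ?IH1.
- move=> e p1 IH1 p2 IH2 s; rewrite mem_cat negb_or => /andP[h1 h2].
  by case: ifP => _; [apply: IH1|apply: IH2].
- move=> x c p1 IH s; rewrite inE negb_or => /andP[/negPf hx h1].
  by elim: (s.1 0 c) => [|j IHj] /=; rewrite /set_mem hx //= IH.
Qed.

Lemma wf_writes p : wf p -> 0 \notin writes p.
Proof.
elim: p => //=.
- by move=> a e1 e2 /and3P[h _ _]; rewrite inE eq_sym.
- by move=> p1 IH1 p2 IH2 /andP[h1 h2]; rewrite mem_cat negb_or IH1 ?IH2.
- by move=> e p1 IH1 p2 IH2 /and3P[_ h1 h2]; rewrite mem_cat negb_or IH1 ?IH2.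
- by move=> x c p IH /and4P[h _ _ h1]; rewrite inE eq_sym negb_or h IH.
Qed.

Lemma sem_silent p s : ~~ emits p -> (sem p s).2 = s.2.
Proof.
elim: p s => //=.
- by move=> p1 IH1 p2 IH2 s; rewrite negb_or => /andP[h1 h2]; rewrite IH2 ?IH1.
- move=> e p1 IH1 p2 IH2 s; rewrite negb_or => /andP[h1 h2].
  by case: ifP => _; [apply: IH1|apply: IH2].
- move=> x c p1 IH s h1.
  by elim: (s.1 0 c) => [|j IHj] //=; rewrite IH.
Qed.

(** Loop rule with a built-in frame: the body may assume that every array outside [x :: writes p]
    still has its value from before the loop, so invariants only mention what changes. *)
Lemma sem_for (Inv : nat -> config -> Prop) x c p s :
    x \notin writes p ->
    Inv 0 (set_counter x 0 s) ->
    (forall i s', i < s.1 0 c -> s'.1 x 0 = i ->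
       (forall a j, a \notin x :: writes p -> s'.1 a j = s.1 a j) ->
       Inv i s' -> Inv i.+1 (set_counter x i.+1 (sem p s'))) ->
  Inv (s.1 0 c) (sem (PFor x c p) s).
Proof.
move=> hx h0 hS /=.
set st := fun j => iteri j (fun i s' => set_counter x i.+1 (sem p s')) (set_counter x 0 s).
have frame j a i : a \notin x :: writes p -> (st j).1 a i = s.1 a i.
  rewrite inE negb_or => /andP[/negPf ax ap].
  by elim: j => [|j IH] /=; rewrite /set_mem ax //= sem_frame.
suff H j : j <= s.1 0 c -> Inv j (st j) /\ (st j).1 x 0 = j by case: (H _ (leqnn _)).
elim: j => [|j IH] hj /=; first by split=> //; rewrite /set_mem !eqxx.
have [hI hv] := IH (ltnW hj).
by split; [apply: hS => // a i; apply: frame|rewrite /set_mem !eqxx].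
Qed.

(** * Bit lengths of values and the cost of evaluation *)

Lemma ltn_bitlen n : n < 2 ^ bitlen n.
Proof. exact: trunc_log_ltn. Qed.

Lemma bitlen_leq n b : 0 < b -> n < 2 ^ b -> bitlen n <= b.
Proof.
move=> b0 h; rewrite /bitlen.
case: n h => [|n] h; first by rewrite trunc_log0.
rewrite -(ltn_exp2l _ _ (isT : 1 < 2)).
by apply: leq_ltn_trans h; apply: trunc_logP.
Qed.

Lemma bitlen_mono m n : m <= n -> bitlen m <= bitlen n.
Proof. by move=> h; apply: bitlen_leq => //; apply: leq_ltn_trans (ltn_bitlen n). Qed.

Lemma bitlenD m n b : bitlen m <= b -> bitlen n <= b -> bitlen (m + n) <= b.+1.
Proof.
move=> hm hn; apply: bitlen_leq => //; rewrite expnS mul2n -addnn.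
have hp c d : c <= d -> 2 ^ c <= 2 ^ d by move=> ?; rewrite leq_exp2l.
have := leq_trans (ltn_bitlen m) (hp _ _ hm).
have := leq_trans (ltn_bitlen n) (hp _ _ hn).
lia.
Qed.

Lemma bitlenM m n : bitlen (m * n) <= bitlen m + bitlen n.
Proof.
apply: bitlen_leq => //; rewrite expnD.
by apply: ltn_mul; apply: ltn_bitlen.
Qed.

Fixpoint expr_size (e : expr) : nat :=
  match e with
  | Cst n => bitlen n
  | Get _ e1 => (expr_size e1).+1
  | Bin _ e1 e2 => (expr_size e1 + expr_size e2).+1
  end.

Fixpoint max_expr_size (p : prog) : nat :=
  match p with
  | PSkip => 0
  | PStore _ e1 e2 => maxn (expr_size e1) (expr_size e2)
  | PEmit e => expr_size e
  | PSeq p1 p2 => maxn (max_expr_size p1) (max_expr_size p2)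
  | PIf e p1 p2 =>
      maxn (expr_size e) (maxn (max_expr_size p1) (max_expr_size p2))
  | PFor _ _ p1 => max_expr_size p1
  end.

Section Cost.
Variables (L0 : nat).
Hypothesis L0_gt0 : 0 < L0.

(** Two bounds: [L] grows during the run, while the input array keeps the bound [L0]. This is what
    makes factors read from array 0 cheap. *)
Definition mem_bits (L : nat) (m : memory) : Prop :=
  (forall a i, bitlen (m a i) <= L) /\ (forall i, bitlen (m 0 i) <= L0).

(** A sum adds one bit, differences and quotients add none, and the right factor of a tame product
    is a constant or an input number, hence adds a multiple of [L0]. No operation adds two lengths
    that depend on [L]. *)
Lemma bitlen_eval L m e :
  mem_bits L m -> tame e -> bitlen (eval m e) <= L + expr_size e * L0.
Proof.
move=> [hm hm0]; elim: e => [n _|a e IH _|o e1 IH1 e2 IH2] /=.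
- by have := leq_pmulr (bitlen n) L0_gt0; lia.
- by apply: leq_trans (leq_addr _ _); apply: hm.
have hl a : a <= L + (expr_size e1) * L0 -> a <= L + (expr_size e1 + expr_size e2).+1 * L0.
  by move=> h; apply: (leq_trans h); rewrite leq_add2l leq_mul2r; apply/orP; right; lia.
case: o => [/andP[/IH1 h1 /IH2 h2]|/andP[/IH1 h1 _]||/andP[/IH1 h1 _]] /=.
- apply: (@leq_trans (L + (expr_size e1 + expr_size e2) * L0).+1); last by nia.
  by apply: bitlenD; nia.
- by apply: hl; apply: leq_trans h1; apply: bitlen_mono; apply: leq_subr.
- move=> /and3P[/IH1 h1 t2 h2]; apply: (leq_trans (bitlenM _ _)).
  suff h3 : bitlen (eval m e2) <= (expr_size e2).+1 * L0 by nia.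
  case: e2 h2 {IH2 t2 hl} => [n|[|a] e2|] //= _; last first.
    by have := hm0 (eval m e2); nia.
  by nia.
- by apply: hl; apply: leq_trans h1; apply: bitlen_mono; apply: leq_div.
Qed.

(** Each node is charged for at most three numbers, and each of them is bounded by [bitlen_eval]. *)
Lemma eval_cost_leq L m e : mem_bits L m -> tame e ->
  eval_cost m e <= 3 * expr_size e * (L + expr_size e * L0).
Proof.
move=> hm.
have hL S S' : S <= S' -> L + S * L0 <= L + S' * L0 by move=> ?; rewrite leq_add2l leq_mul2r; apply/orP; right.
elim: e => [n _|a e IH t|o e1 IH1 e2 IH2 t] /=.
- have := leq_pmulr (bitlen n) L0_gt0; have : 0 < bitlen n by [].
  nia.
- have := IH t; have b1 := bitlen_eval (e := e) hm t.
  have := bitlen_eval (e := Get a e) hm t => /=.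
  have hXY := hL _ _ (leqnSn (expr_size e)).
  have := leq_mul (leqnn (expr_size e)) hXY; move: hXY b1.
  move: (L + (expr_size e).+1 * _) (L + expr_size e * _) => X Y; lia.
- have /andP[t1 t2] : tame e1 && tame e2 by case: (o) t => //= /and3P[-> ->].
  have := IH1 t1; have := IH2 t2.
  have b1 := bitlen_eval hm t1; have b2 := bitlen_eval hm t2.
  have := bitlen_eval (e := Bin o e1 e2) hm t => /=.
  have h1 := hL _ _ (leqW (leq_addr (expr_size e2) (expr_size e1))).
  have h2 := hL _ _ (leqW (leq_addl (expr_size e1) (expr_size e2))).
  have := leq_mul (leqnn (expr_size e1)) h1.
  have := leq_mul (leqnn (expr_size e2)) h2.
  move: b1 b2 h1 h2; move: (L + expr_size e1 * _) (L + expr_size e2 * _) (L + (_ + _).+1 * _) => X Y Z.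
  lia.
Qed.

(** [N] bounds every loop. The two extra steps per round are the guard and the increment; the two
    outside are the reset of the counter and the last guard. *)
Fixpoint steps (N : nat) (p : prog) : nat :=
  match p with
  | PSkip | PStore _ _ _ | PEmit _ => 1
  | PSeq p1 p2 => steps N p1 + steps N p2
  | PIf _ p1 p2 => (steps N p1 + steps N p2).+1
  | PFor _ _ p1 => N * (steps N p1).+2 + 2
  end.

Section Steps.
Variables (S N : nat).
(** Room for the guards and increments that [compile] inserts, which [max_expr_size] does not
    see. *)
Hypothesis S_large : 9 < S.

(** A store is the dearest step: two evaluations with factor 3 each, and two bit lengths. *)
Definition unit_cost (L : nat) : nat := 8 * S * (L + S * L0).

(** Each of the [k] steps lengthens memory by at most [S * L0] bits and is paid at the final length.
    Quantifying over [L] inside lets runs be composed: the second one starts from the length left by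
    the first. *)
Definition runs_in (c : cmd) (s s' : config) (k : nat) : Prop :=
  forall L, mem_bits L s.1 ->
  exists T, [/\ exec c s s' T,
    T <= k * unit_cost (L + k * (S * L0)) & mem_bits (L + k * (S * L0)) s'.1].

Lemma unit_cost_mono L L' : L <= L' -> unit_cost L <= unit_cost L'.
Proof. by move=> h; rewrite leq_mul2l leq_add2r h orbT. Qed.

Lemma mem_bitsW L L' m : L <= L' -> mem_bits L m -> mem_bits L' m.
Proof. by move=> h [h1 h2]; split=> // a i; apply: leq_trans h. Qed.

Lemma bitlen_evalS L m e : mem_bits L m -> tame e -> expr_size e <= S ->
  bitlen (eval m e) <= L + S * L0.
Proof.
move=> hm te he; apply: (leq_trans (bitlen_eval hm te)).
by rewrite leq_add2l leq_mul2r he orbT.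
Qed.

Lemma eval_cost_leqS L m e : mem_bits L m -> tame e -> expr_size e <= S ->
  eval_cost m e <= 3 * S * (L + S * L0).
Proof.
move=> hm te he; apply: (leq_trans (eval_cost_leq hm te)).
by rewrite leq_mul ?leq_add2l ?leq_mul2r ?leq_mul2l ?he ?orbT.
Qed.

Lemma runs_inW c s s' k k' : k <= k' -> runs_in c s s' k -> runs_in c s s' k'.
Proof.
move=> hk h L /h [T [h1 h2 h3]].
have hL : L + k * (S * L0) <= L + k' * (S * L0) by rewrite leq_add2l leq_mul2r hk orbT.
exists T; split=> //; last exact: mem_bitsW h3.
by apply: (leq_trans h2); rewrite leq_mul ?unit_cost_mono.
Qed.

Lemma runs_in_seq c1 c2 s s' s'' k1 k2 :
  runs_in c1 s s' k1 -> runs_in c2 s' s'' k2 ->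
  runs_in (Seq c1 c2) s s'' (k1 + k2).
Proof.
move=> h1 h2 L /h1 [T1 [e1 l1 /h2 [T2 [e2 l2 b2]]]].
exists (T1 + T2); split; first exact: ExecSeq e1 e2.
  rewrite mulnDl leq_add //; last by rewrite mulnDl addnA.
  by apply: (leq_trans l1); rewrite leq_mul ?unit_cost_mono // leq_add2l leq_mul2r leq_addr orbT.
by rewrite mulnDl addnA.
Qed.

Lemma runs_in_store m out a e1 e2 :
  a != 0 -> tame e1 -> tame e2 -> expr_size e1 <= S -> expr_size e2 <= S ->
  runs_in (Store a e1 e2) (m, out)
    (set_mem m a (eval m e1) (eval m e2), out) 1.
Proof.
move=> a0 t1 t2 s1 s2 L /= hm; exists (eval_cost m e1 + eval_cost m e2 + bitlen (eval m e1) + bitlen (eval m e2)).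
split; first exact: ExecStore.
  rewrite mul1n; apply: (@leq_trans (unit_cost L)); last by apply: unit_cost_mono; apply: leq_addr.
  have := eval_cost_leqS hm t1 s1; have := eval_cost_leqS hm t2 s2.
  have := bitlen_evalS hm t1 s1; have := bitlen_evalS hm t2 s2.
  rewrite /unit_cost; have : L + S * L0 <= S * (L + S * L0) by rewrite leq_pmull //; lia.
  move: (L + S * L0) => X; lia.
have hb := bitlen_evalS hm t2 s2; case: hm => h1 h2.
split=> [b i|i] /=; rewrite /set_mem.
  by case: ifP => _; rewrite mul1n //; apply: leq_trans (h1 _ _) (leq_addr _ _).
by rewrite eq_sym (negPf a0); apply: h2.
Qed.

Lemma runs_in_emit m out e : tame e -> expr_size e <= S ->
  runs_in (Emit e) (m, out) (m, rcons out (eval m e)) 1.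
Proof.
move=> t1 s1 L /= hm; exists (eval_cost m e + bitlen (eval m e)).
split; first exact: ExecEmit.
  rewrite mul1n; apply: (@leq_trans (unit_cost L)); last by apply: unit_cost_mono; apply: leq_addr.
  have := eval_cost_leqS hm t1 s1; have := bitlen_evalS hm t1 s1.
  rewrite /unit_cost; have : L + S * L0 <= S * (L + S * L0) by rewrite leq_pmull //; lia.
  move: (L + S * L0) => X; lia.
by apply: mem_bitsW hm; apply: leq_addr.
Qed.

Lemma guard_leq L m e k : mem_bits L m -> tame e -> expr_size e <= S ->
  eval_cost m e <= unit_cost (L + k).
Proof.
move=> hm te se; apply: (leq_trans (eval_cost_leqS hm te se)).
apply: (@leq_trans (unit_cost L)); last by apply: unit_cost_mono; apply: leq_addr.
by rewrite /unit_cost leq_mul // leq_mul.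
Qed.

Lemma runs_in_if s s' e c1 c2 k1 k2 : tame e -> expr_size e <= S ->
  (eval s.1 e != 0 -> runs_in c1 s s' k1) ->
  (eval s.1 e = 0 -> runs_in c2 s s' k2) ->
  runs_in (If e c1 c2) s s' (k1 + k2).+1.
Proof.
move=> te se h1 h2 L hm.
have hc k := guard_leq k hm te se.
have [e0|e0] := eqVneq (eval s.1 e) 0.
  have [T [x1 x2 x3]] := runs_inW (leq_addl k1 k2) (h2 e0) hm.
  exists (eval_cost s.1 e + T); split; first exact: ExecIfFalse.
    rewrite mulSn leq_add ?hc //; apply: (leq_trans x2).
    by rewrite leq_mul ?unit_cost_mono // leq_add2l leq_mul2r leqnSn orbT.
  by apply: mem_bitsW x3; rewrite leq_add2l leq_mul2r leqnSn orbT.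
have [T [x1 x2 x3]] := runs_inW (leq_addr k2 k1) (h1 e0) hm.
exists (eval_cost s.1 e + T); split; first exact: ExecIfTrue.
  rewrite mulSn leq_add ?hc //; apply: (leq_trans x2).
  by rewrite leq_mul ?unit_cost_mono // leq_add2l leq_mul2r leqnSn orbT.
by apply: mem_bitsW x3; rewrite leq_add2l leq_mul2r leqnSn orbT.
Qed.

Lemma runs_in_while_stop s e c : tame e -> expr_size e <= S ->
  eval s.1 e = 0 -> runs_in (While e c) s s 1.
Proof.
move=> te se e0 L hm; exists (eval_cost s.1 e); split; first exact: ExecWhileFalse.
  by rewrite mul1n guard_leq.
by apply: mem_bitsW hm; apply: leq_addr.
Qed.

Lemma runs_in_while s s' s'' e c k1 k2 : tame e -> expr_size e <= S ->
  eval s.1 e != 0 -> runs_in c s s' k1 -> runs_in (While e c) s' s'' k2 ->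
  runs_in (While e c) s s'' (k1 + k2).+1.
Proof.
move=> te se e0 h1 h2 L hm.
have [T1 [x1 x2 x3]] := h1 L hm; have [T2 [y1 y2 y3]] := h2 _ x3.
exists (eval_cost s.1 e + T1 + T2); split; first exact: ExecWhileTrue x1 y1.
  rewrite -addnA mulSn leq_add ?guard_leq // mulnDl leq_add //.
    apply: (leq_trans x2); rewrite leq_mul ?unit_cost_mono // leq_add2l leq_mul2r.
    by apply/orP; right; lia.
  apply: (leq_trans y2); rewrite leq_mul ?unit_cost_mono // -addnA leq_add2l -mulnDl leq_mul2r.
  by apply/orP; right; lia.
apply: mem_bitsW y3; rewrite -addnA leq_add2l -mulnDl leq_mul2r.
by apply/orP; right; lia.
Qed.

Lemma compile_runs p s : wf p -> max_expr_size p <= S ->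
  s.1 0 0 <= N -> s.1 0 1 <= N -> runs_in (compile p) s (sem p s) (steps N p).
Proof.
elim: p s => /=.
- move=> s _ _ _ _ L hm; exists 1; split; first exact: ExecSkip.
    by rewrite mul1n /unit_cost muln_gt0; nia.
  by apply: mem_bitsW hm; apply: leq_addr.
- by move=> a e1 e2 [m out] /= /and3P[? ? ?]; rewrite geq_max => /andP[? ?] _ _; apply: runs_in_store.
- by move=> e [m out] /= ? ? _ _; apply: runs_in_emit.
- move=> p1 IH1 p2 IH2 s /andP[w1 w2]; rewrite geq_max => /andP[m1 m2] n0 n1.
  have hf c : (sem p1 s).1 0 c = s.1 0 c by rewrite sem_frame ?wf_writes.
  by apply: runs_in_seq; [apply: IH1|apply: IH2]; rewrite ?hf.
- move=> e p1 IH1 p2 IH2 s /and3P[te w1 w2]; rewrite !geq_max => /and3P[me m1 m2] n0 n1.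
  apply: runs_in_if => // [e0|e0]; last by rewrite e0 eqxx; apply: IH2.
  by rewrite e0; apply: IH1.
- move=> x c p IH s /and4P[x0 c2 xp wp] mp n0 n1.
  set n := s.1 0 c; set g := Bin _ _ _.
  set st := fun j => iteri j (fun i s' => set_counter x i.+1 (sem p s')) (set_counter x 0 s).
  have x0' := negPf x0.
  have st0 j i : (st j).1 0 i = s.1 0 i.
    elim: j => [|j IHj] /=; first by rewrite /set_mem eq_sym x0'.
    by rewrite {1}/set_mem eq_sym x0' /= sem_frame ?wf_writes.
  have stx j : (st j).1 x 0 = j by case: j => [|j] /=; rewrite /set_mem !eqxx.
  have nN : n <= N by rewrite /n; case: (c) c2 => [|[|]].
  have cS : expr_size (Cst 0) <= S by rewrite /= /bitlen trunc_log0; lia.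
  have gS : expr_size g <= S.
    by case: (c) @g c2 => [|[|]] //= _; rewrite /bitlen ?trunc_log0 ?trunc_log1; lia.
  have iS : expr_size (Bin Add (var x) (Cst 1)) <= S.
    by rewrite /= /bitlen ?trunc_log0 ?trunc_log1; lia.
  have gE j : eval (st j).1 g = n - j by rewrite /= stx st0.
  (* Induction on the number of rounds left, since a run of [While] is extended at its front. *)
  have hW i : i <= n -> runs_in (While g
      (Seq (compile p) (Store x (Cst 0) (Bin Add (var x) (Cst 1)))))
      (st (n - i)) (st n) (i * (steps N p).+2).+1.
    elim: i => [_|i IHi hi].
      by rewrite subn0; apply: runs_in_while_stop; rewrite // gE subnn.
    have e1 : n - i = (n - i.+1).+1 by lia.
    apply: (@runs_inW _ _ _ ((steps N p + 1) + (i * (steps N p).+2).+1).+1).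
      by rewrite mulSn; lia.
    apply: runs_in_while (IHi (ltnW hi)) => //; first by rewrite gE; lia.
    rewrite e1; set j := n - i.+1.
    apply: (runs_in_seq (s' := sem p (st j))).
      by apply: IH; rewrite ?st0.
    have -> : st j.+1 = (set_mem (sem p (st j)).1 x (eval (sem p (st j)).1 (Cst 0))
        (eval (sem p (st j)).1 (Bin Add (var x) (Cst 1))), (sem p (st j)).2).
      by rewrite /= /set_counter sem_frame // stx addn1.
    by case: (sem p (st j)) => m out; apply: runs_in_store.
  apply: (@runs_inW _ _ _ (1 + (n * (steps N p).+2).+1)).
    by rewrite add1n addn2 !ltnS leq_mul2r nN orbT.
  apply: (runs_in_seq (s' := set_counter x 0 s)).
    by rewrite /set_counter; case: (s) => m out; apply: runs_in_store.
  by have := hW n (leqnn _); rewrite subnn.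
Qed.

End Steps.

End Cost.

(** * Polynomial running time *)

Lemma steps_poly p : exists a d, forall N, steps N p <= a * N.+1 ^ d.
Proof.
have up N d d' : d <= d' -> N.+1 ^ d <= N.+1 ^ d' by move=> ?; rewrite leq_pexp2l.
elim: p => /=.
- by exists 1, 0.
- by move=> *; exists 1, 0.
- by move=> *; exists 1, 0.
- move=> p1 [a1 [d1 h1]] p2 [a2 [d2 h2]]; exists (a1 + a2), (maxn d1 d2) => N.
  rewrite mulnDl leq_add //.
    by apply: (leq_trans (h1 N)); rewrite leq_mul2l up ?leq_maxl ?orbT.
  by apply: (leq_trans (h2 N)); rewrite leq_mul2l up ?leq_maxr ?orbT.
- move=> _ p1 [a1 [d1 h1]] p2 [a2 [d2 h2]]; exists (a1 + a2 + 1), (maxn d1 d2) => N.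
  rewrite -addn1 !mulnDl !leq_add //.
  + by apply: (leq_trans (h1 N)); rewrite leq_mul2l up ?leq_maxl ?orbT.
  + by apply: (leq_trans (h2 N)); rewrite leq_mul2l up ?leq_maxr ?orbT.
  + by rewrite mul1n expn_gt0.
- move=> _ _ p [a [d h]]; exists (a + 4), d.+1 => N.
  have := h N; rewrite expnS; have : 0 < N.+1 ^ d by rewrite expn_gt0.
  move: (N.+1 ^ d) => X; nia.
Qed.

Lemma bitsize_cons x s : bitsize (x :: s) = bitlen x + bitsize s.
Proof. by rewrite /bitsize big_cons. Qed.

Lemma size_bitsize s : size s <= bitsize s.
Proof. by elim: s => // x s IH; rewrite bitsize_cons /=; have : 0 < bitlen x by []; lia. Qed.

Lemma bitlen_nth s i : bitlen (nth 0 s i) <= (bitsize s).+1.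
Proof.
elim: s i => [|x s IH] [|i] //=; rewrite ?nth_nil ?/bitlen ?trunc_log0 //.
  by rewrite bitsize_cons /bitlen; lia.
by rewrite bitsize_cons; apply: (leq_trans (IH i)); lia.
Qed.

(** With B the input length, k steps at memory length up to B + 1 + k S (B + 1) cost O(k^2 (B + 1));
    as k is at most [a * B.+1 ^ d], the degree is [d + d.+1]. The power of 2 in the constant pays
    for replacing [B.+1] by [2 * B]. *)
Lemma compile_polynomial p : wf p -> exists a d, forall inp : seq nat,
  0 < bitsize inp -> nth 0 inp 0 <= bitsize inp -> nth 0 inp 1 <= bitsize inp ->
  exists T, run (compile p) inp (sem p (load inp, [::])).2 T /\
            T <= a * bitsize inp ^ d.
Proof.
move=> wp; have [a [d h]] := steps_poly p.
pose S := maxn 10 (max_expr_size p).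
exists (8 * S * a * (1 + a * S + S) * 2 ^ (d + d.+1)), (d + d.+1) => inp.
set B := bitsize inp => B0 h0 h1.
have hm : mem_bits B.+1 B.+1 (load inp).
  by split=> [[|b] i|i] /=; rewrite /load //= ?bitlen_nth // /bitlen trunc_log0.
have := @compile_runs B.+1 isT S B (leq_maxl _ _) p (load inp, [::]) wp (leq_maxr _ _) h0 h1 B.+1 hm.
move=> [T [e l _]]; exists T; split.
  by exists (sem p (load inp, [::])).1; rewrite -surjective_pairing.
apply: (leq_trans l); move: (h B) => hB; rewrite /unit_cost.
rewrite -[X in _ <= X]mulnA -expnMn.
have hM : B.+1 ^ (d + d.+1) <= (2 * B) ^ (d + d.+1) by rewrite leq_exp2r ?addnS //; lia.
apply: (@leq_trans (8 * S * a * (1 + a * S + S) * B.+1 ^ (d + d.+1))); last first.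
  by rewrite leq_mul2l hM orbT.
rewrite expnD expnS.
set M := B.+1; have M0 : 0 < M ^ d by rewrite expn_gt0.
set k := steps B p in hB *; have {}hB : k <= a * M ^ d := hB.
move: (M ^ d) M0 hB => X X0 hB.
have l1 : k * (S * M) <= a * X * (S * M) by rewrite leq_mul2r hB orbT.
apply: (@leq_trans (a * X * (8 * S * (M + a * X * (S * M) + S * M)))).
  by rewrite leq_mul // leq_mul2l leq_add2r leq_add2l l1 orbT.
rewrite [X in _ <= X](_ : _ = a * X * (8 * S * (X * M + a * X * (S * M) + X * (S * M)))); last by ring.
by rewrite leq_mul2l leq_mul2l !leq_add ?leq_pmull ?orbT.
Qed.

(** * Bellman-Ford distances *)

Fixpoint min_upto (b : nat) (f : nat -> nat) (n : nat) : nat :=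
  if n is i.+1 then minn (min_upto b f i) (f i) else b.

Lemma min_upto_le b f n : min_upto b f n <= b.
Proof. by elim: n => //= n IH; apply: leq_trans (geq_minl _ _) IH. Qed.

Lemma min_upto_leq b f n i : i < n -> min_upto b f n <= f i.
Proof.
elim: n => //= n IH; rewrite ltnS leq_eqVlt => /orP[/eqP->|/IH].
  exact: geq_minr.
by apply: leq_trans; apply: geq_minl.
Qed.

Lemma min_upto_attained b f n :
  min_upto b f n = b \/ exists2 i, i < n & min_upto b f n = f i.
Proof.
elim: n => [|n IH] /=; first by left.
case: (leqP (min_upto b f n) (f n)) => h; last by right; exists n.
by case: IH => [->|[i hi ->]]; [left|right; exists i => //; apply: ltnW].
Qed.

Section BellmanFord.
Variables (w : nat -> nat -> nat) (N : nat).

(* The least cost of a walk from [v] with at most [r] edges among the vertices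
   below [N], where ending at [u] costs [f0 u]. *)
Fixpoint bf (f0 : nat -> nat) (r v : nat) : nat :=
  if r is r'.+1 then min_upto (bf f0 r' v) (fun u => w v u + bf f0 r' u) N
  else f0 v.

Section Fixed.
Variable (f0 : nat -> nat).

Lemma bfS_leq r v : bf f0 r.+1 v <= bf f0 r v.
Proof. exact: min_upto_le. Qed.

Lemma bfS_edge r v u : u < N -> bf f0 r.+1 v <= w v u + bf f0 r u.
Proof. exact: min_upto_leq. Qed.

Lemma bf_leq r r' v : r <= r' -> bf f0 r' v <= bf f0 r v.
Proof.
elim: r' => [|r' IH]; first by rewrite leqn0 => /eqP->.
rewrite leq_eqVlt => /orP[/eqP-> //|]; rewrite ltnS => /IH.
exact: leq_trans (bfS_leq _ _).
Qed.

Fixpoint walk_cost (v : nat) (p : seq nat) : nat :=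
  if p is u :: q then w v u + walk_cost u q else f0 v.

Lemma bf_walk r v p :
  all (gtn N) p -> size p <= r -> bf f0 r v <= walk_cost v p.
Proof.
elim: r v p => [|r IH] v [|u p] //=; first by move=> _ _; apply: (bf_leq v (leq0n r.+1)).
move=> /andP[hu hp] hs; apply: (leq_trans (bfS_edge _ _ hu)).
by rewrite leq_add2l IH.
Qed.

Lemma bf_attained r v :
  exists2 p, all (gtn N) p & walk_cost v p = bf f0 r v.
Proof.
elim: r v => [|r IH] v; first by exists [::].
case: (min_upto_attained (bf f0 r v) (fun u => w v u + bf f0 r u) N) => /=.
  by move=> ->; apply: IH.
move=> [u hu ->]; have [p hp <-] := IH u.
by exists (u :: p) => //=; rewrite hu.
Qed.

Lemma walk_suffix v u p : v \in u :: p -> all (gtn N) p -> uniq (u :: p) ->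
  exists q, [/\ all (gtn N) q, uniq (v :: q) & walk_cost v q <= walk_cost u p].
Proof.
elim: p u => [|x p IH] u; first by rewrite inE => /eqP-> _ _; exists [::].
rewrite inE => /orP[/eqP->|hv] hp hu; first by exists (x :: p).
have [||q [q1 q2 q3]] := IH x hv; [by case/andP: hp|by case/andP: hu|].
by exists q; split=> //=; apply: (leq_trans q3); apply: leq_addl.
Qed.

Lemma walk_uniq v p : all (gtn N) p ->
  exists q, [/\ all (gtn N) q, uniq (v :: q) & walk_cost v q <= walk_cost v p].
Proof.
elim: p v => [|u p IH] v /=; first by exists [::].
move=> /andP[hu /IH-/(_ u)[q [q1 q2 q3]]].
have [hv|hv] := boolP (v \in u :: q).
  have [q' [h1 h2 h3]] := walk_suffix hv q1 q2.
  by exists q'; split=> //; apply: (leq_trans h3); apply: (leq_trans q3); apply: leq_addl.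
by exists (u :: q); rewrite /= hu hv; split=> //; rewrite leq_add2l.
Qed.

(** Weights are natural numbers, so cutting cycles never raises the cost. A walk on distinct
    vertices below [N], its start included, has fewer than [N] edges: further rounds gain
    nothing. *)
Lemma bf_stable r v : v < N -> bf f0 N v <= bf f0 r v.
Proof.
move=> hv; have [p hp <-] := bf_attained r v.
have [q [q1 q2 q3]] := walk_uniq v hp.
apply: leq_trans q3; apply: bf_walk => //; apply: ltnW.
rewrite -(size_iota 0 N) -[(size q).+1]/(size (v :: q)).
apply: (@uniq_leq_size _ _ (iota 0 N)) => // x; rewrite mem_iota /= add0n inE.
by move=> /orP[/eqP->|/(allP q1)].
Qed.

Lemma bf_edge v u : v < N -> u < N -> bf f0 N v <= w v u + bf f0 N u.
Proof. by move=> hv hu; apply: (leq_trans (bf_stable N.+1 hv)); apply: bfS_edge. Qed.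

End Fixed.

Variable (inf : nat).

(** As [inf] is a finite number, [dist q] is the distance to [q] cut off at [inf]. The triangle
    inequality along edges survives the cut-off. *)
Definition only_at (q v : nat) : nat := if v == q then 0 else inf.

Definition dist (q v : nat) : nat := bf (only_at q) N v.

Lemma dist_refl q : dist q q = 0.
Proof.
apply/eqP; rewrite -leqn0; apply: leq_trans (bf_leq _ _ (leq0n N)) _.
by rewrite /= /only_at eqxx.
Qed.

Lemma dist_inf q v : dist q v <= inf.
Proof.
apply: leq_trans (bf_leq _ _ (leq0n N)) _.
by rewrite /= /only_at; case: ifP.
Qed.

Lemma dist_edge q v u : v < N -> u < N -> dist q v <= w v u + dist q u.
Proof. exact: bf_edge. Qed.

(** [bf] adds edges at the start of a walk, whereas reversing a walk adds them at its end. This is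
    the step that makes [dist] symmetric when [w] is. *)
Lemma bf_last_edge r q u v : u < N -> q < N ->
  bf (only_at q) r.+1 v <= bf (only_at u) r v + w u q.
Proof.
move=> hu hq; elim: r v => [|r IH] v.
  have [->|hvu] := eqVneq v u.
    apply: (leq_trans (bfS_edge _ _ _ hq)).
    by rewrite /= /only_at !eqxx addn0.
  apply: leq_trans (bf_leq _ _ (leq0n 1)) _.
  by rewrite /= /only_at (negPf hvu); case: ifP => // _; apply: leq_addr.
case: (min_upto_attained (bf (only_at u) r v) (fun x => w v x + bf (only_at u) r x) N).
  rewrite -[min_upto _ _ _]/(bf (only_at u) r.+1 v) => ->.
  exact: leq_trans (bfS_leq _ _ _) (IH v).
rewrite -[min_upto _ _ _]/(bf (only_at u) r.+1 v) => -[x hx ->].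
apply: (leq_trans (bfS_edge _ _ _ hx)).
by rewrite -addnA leq_add2l IH.
Qed.

Lemma dist_last_edge q u v : v < N -> u < N -> q < N ->
  dist q v <= dist u v + w u q.
Proof.
move=> hv hu hq; apply: leq_trans (bf_last_edge _ _ hu hq).
exact: bf_stable.
Qed.

Hypothesis w_sym : forall u v, u < N -> v < N -> w u v = w v u.

Lemma dist_sym_leq r q v : q < N -> v < N -> dist v q <= bf (only_at q) r v.
Proof.
move=> hq; elim: r v => [|r IH] v hv.
  rewrite /= /only_at; have [->|_] := eqVneq v q; first by rewrite dist_refl.
  exact: dist_inf.
case: (min_upto_attained (bf (only_at q) r v) (fun x => w v x + bf (only_at q) r x) N).
  by rewrite -[min_upto _ _ _]/(bf (only_at q) r.+1 v) => ->; apply: IH.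
rewrite -[min_upto _ _ _]/(bf (only_at q) r.+1 v) => -[x hx ->].
apply: (leq_trans (dist_last_edge hq hx hv)).
by rewrite (w_sym hx hv) addnC leq_add2l IH.
Qed.

Lemma dist_sym q v : q < N -> v < N -> dist q v = dist v q.
Proof. by move=> hq hv; apply/eqP; rewrite eqn_leq !dist_sym_leq. Qed.

End BellmanFord.

(** * Reading an instance *)

Lemma size_flatten_const (T : Type) c (ss : seq (seq T)) :
  all (fun s => size s == c) ss -> size (flatten ss) = size ss * c.
Proof. by elim: ss => //= s ss IH /andP[/eqP hs /IH]; rewrite size_cat hs mulSn => ->. Qed.

Lemma nth_flatten_const (T : Type) (x0 : T) c (ss : seq (seq T)) i j :
  all (fun s => size s == c) ss -> i < size ss -> j < c ->
  nth x0 (flatten ss) (i * c + j) = nth x0 (nth [::] ss i) j.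
Proof.
elim: ss i => // s ss IH [|i] /= /andP[/eqP hs hss] hi hj; rewrite nth_cat hs.
  by rewrite add0n hj.
by rewrite mulSn -addnA ltnNge leq_addr addKn IH.
Qed.

Section Reading.
Variable I : delivery.

Definition input_nth (j : nat) : nat := nth 0 (encode_instance I) j.
Definition edge_num (u v : nat) : nat := input_nth (4 + (u * nv I + v) * 2).
Definition edge_den (u v : nat) : nat := input_nth (4 + (u * nv I + v) * 2 + 1).
Definition home (i : nat) : nat := input_nth (4 + nv I * nv I * 2 + i * 3).
Definition budget_num (i : nat) : nat :=
  input_nth (4 + nv I * nv I * 2 + i * 3 + 1).
Definition budget_den (i : nat) : nat :=
  input_nth (4 + nv I * nv I * 2 + i * 3 + 2).

Let edge_code (u v : 'I_(nv I)) : seq nat :=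
  if adj u v then encode_rat (weight u v) else [:: 0; 0].
Let matrix := [seq edge_code u v | u <- enum 'I_(nv I), v <- enum 'I_(nv I)].
Let agents :=
  [seq (start i : nat) :: encode_rat (budget i) | i <- enum 'I_(na I)].

Lemma encode_instanceE : encode_instance I =
  [:: nv I; na I; src I : nat; tgt I : nat] ++ flatten matrix ++ flatten agents.
Proof. by []. Qed.

Lemma matrix_size : all (fun s => size s == 2) matrix.
Proof.
by apply/allP => s /allpairsP[[u v] /= [_ _ ->]]; rewrite /edge_code; case: ifP.
Qed.

Lemma agents_size : all (fun s => size s == 3) agents.
Proof. by apply/allP => s /mapP[i _ ->]. Qed.

Lemma size_matrix : size (flatten matrix) = nv I * nv I * 2.
Proof. by rewrite (size_flatten_const matrix_size) size_allpairs -cardE card_ord. Qed.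

Lemma size_encode_instance :
  size (encode_instance I) = 4 + nv I * nv I * 2 + na I * 3.
Proof.
rewrite encode_instanceE !size_cat size_matrix (size_flatten_const agents_size).
by rewrite size_map -cardE card_ord addnA.
Qed.

Lemma input_edge (u v : 'I_(nv I)) j : j < 2 ->
  input_nth (4 + (u * nv I + v) * 2 + j) = nth 0 (edge_code u v) j.
Proof.
move=> hj; rewrite /input_nth encode_instanceE nth_cat /= -addnA addKn.
have hrow : u * nv I + v < nv I * nv I.
  have := ltn_ord u; have := ltn_ord v; nia.
rewrite nth_cat size_matrix ifT; last by lia.
rewrite nth_flatten_const ?matrix_size //; last by rewrite size_allpairs -cardE card_ord.
rewrite /matrix /allpairs.
rewrite (@nth_flatten_const _ [::] (nv I)) ?size_map -?cardE ?card_ord //.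
  rewrite (nth_map u) ?size_enum_ord // nth_ord_enum.
  by rewrite (nth_map v) ?size_enum_ord // nth_ord_enum.
by apply/allP => s /mapP[x _ ->]; rewrite size_map size_enum_ord.
by rewrite -enumT size_enum_ord.
Qed.

Lemma input_agent (i : 'I_(na I)) j : j < 3 ->
  input_nth (4 + nv I * nv I * 2 + i * 3 + j) =
  nth 0 ((start i : nat) :: encode_rat (budget i)) j.
Proof.
move=> hj; rewrite /input_nth encode_instanceE nth_cat /= -!addnA addKn.
rewrite nth_cat size_matrix ltnNge leq_addr /= addKn.
rewrite nth_flatten_const ?agents_size //; last by rewrite size_map size_enum_ord.
by rewrite (nth_map i) ?size_enum_ord // nth_ord_enum.
Qed.

Lemma input_src : input_nth 2 = src I. Proof. by []. Qed.
Lemma input_tgt : input_nth 3 = tgt I. Proof. by []. Qed.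

Lemma edge_num_adj (u v : 'I_(nv I)) : adj u v ->
  edge_num u v = `|numq (weight u v)|%N.
Proof. by move=> h; rewrite /edge_num -[4 + _]addn0 input_edge // /edge_code h. Qed.

Lemma edge_den_adj (u v : 'I_(nv I)) : adj u v ->
  edge_den u v = `|denq (weight u v)|%N.
Proof. by move=> h; rewrite /edge_den input_edge // /edge_code h. Qed.

(** A genuine denominator is positive, so the program recognises edges by their denominators
    alone. *)
Lemma edge_den_nonadj (u v : 'I_(nv I)) : ~~ adj u v -> edge_den u v = 0.
Proof. by move=> /negPf h; rewrite /edge_den input_edge // /edge_code h. Qed.

Lemma homeE (i : 'I_(na I)) : home i = start i.
Proof. by rewrite /home -[4 + _ + _]addn0 input_agent. Qed.

Lemma budget_numE (i : 'I_(na I)) : budget_num i = `|numq (budget i)|%N.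
Proof. by rewrite /budget_num input_agent. Qed.

Lemma budget_denE (i : 'I_(na I)) : budget_den i = `|denq (budget i)|%N.
Proof. by rewrite /budget_den input_agent. Qed.

End Reading.

Section Scaling.
Variables (I : delivery) (Q inf : nat).

(** Length 0 on the diagonal makes a meeting at a vertex the case u = v of a meeting on an edge. *)
Definition len (u v : nat) : nat :=
  if u == v then 0
  else if edge_den I u v == 0 then inf
  else Q %/ edge_den I u v * edge_num I u v * 2.

Definition cap (i : nat) : nat := Q %/ budget_den I i * budget_num I i.

(* [Q] is a common denominator of the weights and budgets, weights are scaled by
   [2 Q] and budgets by [Q]: thus [cap i] is half the budget of [i] at the scale
   of [len]. Non-edges have length [inf]. *)
Record scaled : Prop := Scaled {
  scaled_gt0 : 0 < Q;
  scaled_edge : forall u v, u < nv I -> v < nv I -> edge_den I u v != 0 ->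
    edge_den I u v %| Q;
  scaled_budget : forall i, i < na I -> budget_den I i %| Q;
  scaled_inf : forall i, i < na I -> cap i * 2 < inf
}.

Hypothesis sc : scaled.

Definition d (p v : nat) : nat := dist len (nv I) inf p v.

Lemma lenxx u : len u u = 0.
Proof. by rewrite /len eqxx. Qed.

Lemma len_sym u v : u < nv I -> v < nv I -> len u v = len v u.
Proof.
move=> hu hv; rewrite /len eq_sym; case: ifP => // _.
rewrite -[u]/(val (Ordinal hu)) -[v]/(val (Ordinal hv)).
set x := Ordinal hu; set y := Ordinal hv.
case: (boolP (adj x y)) => a; last by rewrite !edge_den_nonadj // adj_sym.
by rewrite !edge_den_adj ?edge_num_adj // 1?adj_sym // weight_sym.
Qed.

Lemma len_inf (u v : 'I_(nv I)) : len u v < inf -> u != v -> adj u v.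
Proof.
move=> h huv; apply: contraLR h => hn.
by rewrite /len val_eqE (negPf huv) edge_den_nonadj // eqxx ltnn.
Qed.

Section Real.
Variable R : realType.
Local Open Scope ring_scope.

Definition scale : R := 2 * Q%:R.

Lemma scale_gt0 : 0 < scale.
Proof. by rewrite mulr_gt0 ?ltr0n ?(scaled_gt0 sc). Qed.

Lemma scaled_ratr (q : rat) : 0 <= q -> (`|denq q|%N %| Q)%N ->
  (Q %/ `|denq q| * `|numq q|)%:R = Q%:R * ratr q :> R.
Proof.
move=> q0 hd; rewrite natrM /ratr.
have d0 : (`|denq q|%N)%:R != 0 :> R by rewrite pnatr_eq0 absz_eq0 denq_neq0.
have hn : (numq q)%:~R = (`|numq q|%N)%:R :> R.
  by rewrite -{1}[numq q]gez0_abs ?numq_ge0 // pmulrn.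
have hdn : (denq q)%:~R = (`|denq q|%N)%:R :> R.
  by rewrite -{1}[denq q]gez0_abs ?denq_ge0 // pmulrn.
rewrite hn hdn -{2}(divnK hd) natrM -mulrA; congr (_ * _).
by rewrite mulrCA mulfV ?mulr1.
Qed.

Lemma lenE (u v : 'I_(nv I)) : adj u v -> (len u v)%:R = scale * ratr (weight u v).
Proof.
move=> a; have huv : (u == v :> nat) = false.
  by apply/negP => /eqP/val_inj e; move: a; rewrite e adj_irr.
have hd : edge_den I u v != 0%N by rewrite edge_den_adj // absz_eq0 denq_neq0.
have := scaled_edge sc (ltn_ord u) (ltn_ord v) hd.
rewrite /len huv (negPf hd) edge_den_adj // edge_num_adj // => hQ.
by rewrite natrM scaled_ratr ?weight_ge0 // /scale mulrC mulrA.
Qed.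

Lemma capE (i : 'I_(na I)) : (cap i)%:R = Q%:R * ratr (budget i) :> R.
Proof.
have := scaled_budget sc (ltn_ord i); rewrite /cap budget_denE budget_numE => h.
by rewrite scaled_ratr ?budget_ge0.
Qed.

End Real.
End Scaling.

(** * Every feasible schedule yields a chain of linked agents *)

Section Chains.
Variables (I : delivery) (Q inf : nat).
Hypothesis sc : scaled I Q inf.

Local Notation d := (d I Q inf).
Local Notation len := (len I Q inf).
Local Notation cap := (cap I Q).

(* Walking half their budgets, agents [i] and [j] can meet on the edge {u, v},
   or at u when u = v, coming from [u] and [v]. *)
Definition handover (i j u v : nat) : bool :=
  [&& d (home I i) u <= cap i, d (home I j) v <= cap j
    & d (home I i) u + len u v + d (home I j) v <= cap i + cap j].

Definition linked (i j : nat) : Prop :=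
  exists u v, [/\ u < nv I, v < nv I & handover i j u v].

Section Real.
Variable R : realType.
Local Open Scope ring_scope.

Local Notation scale := (scale Q R).
Local Notation step := (@Defs.next R I).
Let sc0 : 0 < scale := scale_gt0 sc R.

(** A point inside an edge is reached through one of its ends, whence the disjunction. *)
Definition near (p : 'I_(nv I)) (l : location (nv I) R) (r : R) : Prop :=
  match l with
  | AtVertex v => (d p v)%:R <= r
  | Inside u v x =>
      0 <= x <= 1 /\ ((d p u)%:R + x * (len u v)%:R <= r
                      \/ (d p v)%:R + (1 - x) * (len u v)%:R <= r)
  end.

Lemma nearW p l r r' : r <= r' -> near p l r -> near p l r'.
Proof.
case: l => [v|u v x] hr /=; first by move=> h; apply: le_trans hr.
by move=> [hx [h|h]]; split=> //; [left|right]; apply: le_trans hr.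
Qed.

(** Hides the normalisation made by [edge_point]. At an end of the edge, the way through the other
    end is covered by the triangle inequality; reversing the edge exchanges the two alternatives. *)
Lemma near_edge_point p u v x r : adj u v -> 0 <= x <= 1 ->
  near p (edge_point u v x) r <->
  ((d p u)%:R + x * (len u v)%:R <= r
   \/ (d p v)%:R + (1 - x) * (len u v)%:R <= r).
Proof.
move=> a hx.
have hl : len u v = len v u by apply: len_sym.
have h1 : (d p u)%:R <= (len u v)%:R + (d p v)%:R :> R.
  by rewrite -natrD ler_nat dist_edge.
have h2 : (d p v)%:R <= (len u v)%:R + (d p u)%:R :> R.
  by rewrite hl -natrD ler_nat dist_edge.
rewrite /edge_point; case: eqP => [->|x0] /=.
  split=> [h|[h|h]]; [left| |]; lra.
case: eqP => [->|x1] /=.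
  split=> [h|[h|h]]; [right| |]; lra.
case: ifP => _ /=; first by split=> [[]|].
have e : 1 - (1 - x) = x by ring.
rewrite e -hl; split=> [[_ [h|h]]|[h|h]]; [by right|by left| |].
  by split; [lra|right].
by split; [lra|left].
Qed.

Lemma near_move p u v x y r : adj u v -> 0 <= x <= 1 -> 0 <= y <= 1 ->
  near p (edge_point u v x) r ->
  near p (edge_point u v y) (`|y - x| * (len u v)%:R + r).
Proof.
move=> a hx hy /(near_edge_point _ _ a hx) h; apply/(near_edge_point _ _ a hy).
have l0 : 0 <= (len u v)%:R :> R by rewrite ler0n.
have := ler_norm (y - x); have := ler_norm (x - y); rewrite distrC => n1 n2.
case: h => h; [left|right]; nra.
Qed.

Lemma scaled_move (i : 'I_(na I)) u v (x y : R) : adj u v ->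
  scale * action_energy i (Move i u v x y) = `|y - x| * (len u v)%:R.
Proof. by move=> a; rewrite /= eqxx (lenE sc) // mulrCA. Qed.

Lemma energy_cons a acts (i : 'I_(na I)) :
  energy (R := R) (a :: acts) i = action_energy i a + energy acts i.
Proof. by rewrite /energy big_cons. Qed.

Lemma energy_cat acts acts' (i : 'I_(na I)) :
  energy (R := R) (acts ++ acts') i = energy acts i + energy acts' i.
Proof. by rewrite /energy big_cat. Qed.

Lemma near_prefix p i acts s r : legal s acts ->
  near p (agent_at s i) r ->
  near p (agent_at (foldl step s acts) i) (scale * energy acts i + r).
Proof.
elim: acts s r => [|a acts IH] s r /=; first by rewrite /energy big_nil mulr0 add0r.
move=> [ha hl] h; rewrite energy_cons mulrDr addrAC addrC.
apply: IH => //; case: a ha {hl} => [j u v x y|j|j] /=; rewrite ?mulr0 ?add0r //.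
case: (eqVneq j i) => [->|hij] [a hx hy hp]; last first.
  by rewrite mulr0 add0r.
have := scaled_move i x y a; rewrite /= eqxx => ->.
by apply: near_move => //; rewrite -hp.
Qed.

(** Read backwards, the remaining moves lead from [p] to the current position at the same cost,
    because energy does not depend on direction. *)
Lemma near_suffix p i acts s : legal s acts ->
  agent_at (foldl step s acts) i = AtVertex p ->
  near p (agent_at s i) (scale * energy acts i).
Proof.
elim: acts s => [|a acts IH] s /=.
  by move=> _ ->; rewrite /energy big_nil mulr0 /= /d dist_refl.
move=> [ha hl] h; have {IH hl h} := IH _ hl h; rewrite energy_cons mulrDr.
case: a ha => [j u v x y|j|j] /=; rewrite ?mulr0 ?add0r //.
case: (eqVneq j i) => [->|hij] [a hx hy hp]; last first.
  by rewrite mulr0 add0r.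
have := scaled_move i x y a; rewrite /= eqxx => -> h.
by rewrite hp distrC; apply: near_move h.
Qed.

(** If both agents come through the same end, they can already meet there. Through opposite ends,
    the two parts of the edge add up to its length, which is the third condition of [handover]. *)
Lemma near_linked (i j : 'I_(na I)) l :
  near (start i) l (cap i)%:R -> near (start j) l (cap j)%:R -> linked i j.
Proof.
have l0 u v : 0 <= (len u v)%:R :> R by rewrite ler0n.
case: l => [v|u v x] /=.
  rewrite !ler_nat => h1 h2; exists v, v; split=> //.
  by rewrite /handover !homeE h1 h2 lenxx addn0 leq_add.
move=> [hx h] [_ h'].
have x1 := mulr_ge0 (andP hx).1 (l0 u v).
have x2 : 0 <= (1 - x) * (len u v)%:R by rewrite mulr_ge0 //; lra.
have same w : (d (start i) w)%:R <= (cap i)%:R :> R -> (d (start j) w)%:R <= (cap j)%:R :> R ->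
    exists2 y, y = w & handover i j y w.
  rewrite !ler_nat => g1 g2; exists w => //.
  by rewrite /handover !homeE g1 g2 lenxx addn0 leq_add.
case: h h' => h [h'|h'].
- by have [||y -> hh] := same u; [lra|lra|exists u, u; split].
- exists u, v; split=> //; rewrite /handover !homeE -!(ler_nat R) !natrD.
  by apply/and3P; split; lra.
- exists v, u; split=> //; rewrite /handover !homeE -!(ler_nat R) !natrD.
  by rewrite (len_sym _ _ (ltn_ord v) (ltn_ord u)); apply/and3P; split; lra.
- by have [||y -> hh] := same v; [lra|lra|exists v, v; split].
Qed.

(** An arbitrary [K] closed under links stands for the agents that a chain from s can reach; no
    chain has to be built. *)
Lemma feasible_chain (acts : seq (action (nv I) (na I) R)) (K : 'I_(na I) -> Prop) :
  feasible (fun i => ratr (budget i)) acts ->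
  (forall i, d (start i) (src I) <= cap i -> K i)%N ->
  (forall i j : 'I_(na I), K i -> linked i j -> K j) ->
  exists2 i, K i & (d (start i) (tgt I) <= cap i)%N.
Proof.
move=> [hl hm hB hret] K0 KS.
have legal_cat s a1 a2 : @legal R I s (a1 ++ a2) <->
    legal s a1 /\ legal (foldl step s a1) a2.
  by elim: a1 s => [|a a1 IH] s /=; [tauto|have := IH (step s a); tauto].
(* The energies before and after any moment add up to at most [2 * cap i], so one of them is at most
   [cap i]. Both bound the distance from home, the second one because the agent must return. *)
have half i a1 a2 : acts = a1 ++ a2 ->
    near (start i) (agent_at (foldl step (initial R I) a1) i) (cap i)%:R.
  move=> e; move: hl (hret i) (hB i); rewrite e => /legal_cat [l1 l2].
  rewrite /final foldl_cat energy_cat => r2 le.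
  have n1 : near (start i) (agent_at (initial R I) i) 0 by rewrite /= /d dist_refl.
  have := near_prefix l1 n1; rewrite addr0 => {}n1.
  have n2 := near_suffix l2 r2.
  have hc := capE sc R i.
  have : scale * energy a1 i + scale * energy a2 i <= 2 * (cap i)%:R.
    by rewrite hc -mulrDr mulrA ler_pM2l // sc0.
  move: n1 n2; move: (scale * energy a1 i) (scale * energy a2 i) => x y n1 n2 hxy.
  by case: (lerP x (cap i)%:R) => hx; [apply: nearW n1|apply: nearW n2; lra].
(* A message at rest is at s or in the ball of an agent of [K]. The position of a carrier need not
   be recorded: [half] supplies it at the next pick or drop. *)
pose inv (s : state (nv I) (na I) R) := match message s with
  | CarriedBy i => K i
  | LiesAt l => l = AtVertex (src I) \/ exists2 i, K i & near (start i) l (cap i)%:R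
  end.
have inv_final a1 a2 : acts = a1 ++ a2 -> inv (foldl step (initial R I) a1) ->
    inv (final acts).
  elim: a2 a1 => [|a a2 IH] a1 e h; first by rewrite e cats0.
  have e' : acts = rcons a1 a ++ a2 by rewrite cat_rcons.
  apply: (IH _ e'); rewrite foldl_rcons.
  have hh i := half i _ _ e; move: hl; rewrite e => /legal_cat [_ /= [ha _]].
  move: ha h hh; set s := foldl _ _ _; rewrite /inv.
  case: a {e e'} => [j u v x y|j|j] //=.
    move=> -> h hj; have {}hj := hj j.
    case: h => [hs|[i Ki hi]]; last by apply: KS Ki _; apply: near_linked hi hj.
    by apply: K0; move: hj; rewrite hs /= ler_nat.
  by move=> -> Kj hj; right; exists j.
have := inv_final [::] acts erefl; rewrite /inv hm => -[]; first by left.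
  by case=> e; have := src_neq_tgt I; rewrite e eqxx.
by case=> i Ki; rewrite /= ler_nat; exists i.
Qed.

End Real.
End Chains.

(** * Schedules written on the output tape *)

Section Building.
Variables (I : delivery) (Q inf : nat).
Hypothesis sc : scaled I Q inf.
Variable R : realType.

Local Notation d := (d I Q inf).
Local Notation len := (len I Q inf).
Local Notation cap := (cap I Q).
Local Notation loc := (location (nv I) R).
Local Notation msg := (message_pos (nv I) (na I) R).
Local Notation real_acts := (map (map_action (@frac_val R))).
Local Open Scope ring_scope.
Local Notation scale := (scale Q R).
Local Notation step := (@Defs.next R I).

(* [out] encodes a legal schedule after which agent [a] is at [l], the others are
   home, the message is at [m], and agent [j] has used energy at most [e j] at
   the scale of [len]. *)
Definition sched (out : seq nat) (a : 'I_(na I)) (l : loc) (m : msg)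
    (e : 'I_(na I) -> nat) : Prop :=
  exists acts : seq (action (nv I) (na I) (nat * nat)),
    [/\ out = 1%N :: encode_schedule acts, all (@positive_dens _ _) acts,
        legal (initial R I) (real_acts acts),
        message (final (real_acts acts)) = m &
        forall j,
          agent_at (final (real_acts acts)) j =
            (if j == a then l else AtVertex (start j)) /\
          scale * energy (real_acts acts) j <= (e j)%:R].

Definition spend (e : 'I_(na I) -> nat) (a : 'I_(na I)) (c : nat) :=
  fun j => (e j + (if j == a then c else 0))%N.

Lemma sched_nil a :
  sched [:: 1%N] a (AtVertex (start a)) (LiesAt (AtVertex (src I))) (fun=> 0%N).
Proof.
exists [::]; split=> // j; rewrite /energy big_nil mulr0; split=> //=.
by case: eqP => // ->.
Qed.

Lemma schedW out a l m e e' : (forall j, e j <= e' j)%N ->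
  sched out a l m e -> sched out a l m e'.
Proof.
move=> he [acts [h1 h2 h3 h4 h5]]; exists acts; split=> // j.
by have [-> h] := h5 j; split=> //; apply: le_trans h _; rewrite ler_nat.
Qed.

(** With everybody at home, the distinguished traveller is a mere name; this passes from the visit
    of one agent to that of the next. *)
Lemma sched_switch out a a' m e :
  sched out a (AtVertex (start a)) m e -> sched out a' (AtVertex (start a')) m e.
Proof.
move=> [acts [h1 h2 h3 h4 h5]]; exists acts; split=> // j.
have [-> h] := h5 j; split=> //.
by do 2 (case: eqP => [->|_] //).
Qed.

Lemma legal_rcons s acts (x : action (nv I) (na I) R) :
  legal s acts -> enabled (foldl step s acts) x -> legal s (rcons acts x).
Proof. by elim: acts s => [|y acts IH] s //= [h1 h2] h3; split=> //; apply: IH. Qed.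

Lemma sched_act out a l m e (x : action (nv I) (na I) (nat * nat)) l' m' c :
  sched out a l m e -> positive_dens x ->
  (forall s : state (nv I) (na I) R, agent_at s a = l -> message s = m ->
     let x' := map_action (@frac_val R) x in
     [/\ enabled s x', message (step s x') = m' &
         forall j, agent_at (step s x') j = if j == a then l' else agent_at s j]) ->
  (forall j, scale * action_energy j (map_action (@frac_val R) x)
             <= (if j == a then c else 0)%N%:R) ->
  sched (out ++ encode_action x) a l' m' (spend e a c).
Proof.
move=> [acts [h1 h2 h3 h4 h5]] hx hs he; exists (rcons acts x).
have [] := hs (final (real_acts acts)) _ h4; first by have [-> _] := h5 a; rewrite eqxx.
move=> g1 g2 g3; rewrite all_rcons hx h2 map_rcons; split=> //.
- by rewrite h1 /encode_schedule map_rcons flatten_rcons.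
- exact: legal_rcons.
- by rewrite /final foldl_rcons.
move=> j; rewrite /final foldl_rcons g3; have [-> h] := h5 j; split; first by case: eqP.
by rewrite /energy -cats1 big_cat big_seq1 /= mulrDr natrD lerD.
Qed.

Lemma frac01 (x : nat * nat) : (x.1 <= x.2)%N -> (0 < x.2)%N -> 0 <= frac_val R x <= 1.
Proof.
move=> h h0; rewrite /frac_val divr_ge0 //= ler_pdivrMr ?ltr0n //.
by rewrite mul1r ler_nat.
Qed.

Lemma sched_move out a u v (x y : nat * nat) m e c : adj u v ->
  (x.1 <= x.2)%N -> (0 < x.2)%N -> (y.1 <= y.2)%N -> (0 < y.2)%N ->
  `|frac_val R y - frac_val R x| * (len u v)%:R <= c%:R ->
  sched out a (edge_point u v (frac_val R x)) m e ->
  sched (out ++ [:: 0%N; a : nat; u : nat; v : nat; x.1; x.2; y.1; y.2]) a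
    (edge_point u v (frac_val R y)) m (spend e a c).
Proof.
move=> hadj hx hx0 hy hy0 hc hs.
apply: (sched_act (x := Move a u v x y) hs) => /=; first by rewrite hx0.
  by move=> s hl hm; split=> //; split=> //; apply: frac01.
move=> j; case: (eqVneq a j) => _; last by rewrite mulr0.
apply: le_trans hc; have := scaled_move sc a (frac_val R x) (frac_val R y) hadj.
by rewrite /= eqxx => ->.
Qed.

Lemma sched_edge out a u v m e : adj u v ->
  sched out a (AtVertex u) m e ->
  sched (out ++ [:: 0%N; a : nat; u : nat; v : nat; 0%N; 1%N; 1%N; 1%N]) a
    (AtVertex v) m (spend e a (len u v)).
Proof.
move=> h hs; have -> : AtVertex v = edge_point u v (frac_val R (1, 1)%N).
  by rewrite /frac_val divr1 /edge_point eqxx oner_eq0.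
apply: (sched_move (x := (0, 1)%N) (y := (1, 1)%N)) => //.
  by rewrite /frac_val mul0r divr1 subr0 normr1 mul1r.
by rewrite /frac_val mul0r /edge_point eqxx.
Qed.

Lemma sched_pick out a l e : sched out a l (LiesAt l) e ->
  sched (out ++ [:: 1%N; a : nat]) a l (CarriedBy a) (spend e a 0%N).
Proof.
move=> hs; apply: (sched_act (x := Defs.Pick a) hs) => //=.
  by move=> s hl hm; split=> //; [rewrite hm hl|move=> j; case: eqP => [->|]].
by move=> j; rewrite mulr0; case: ifP.
Qed.

Lemma sched_drop out a l e : sched out a l (CarriedBy a) e ->
  sched (out ++ [:: 2%N; a : nat]) a l (LiesAt l) (spend e a 0%N).
Proof.
move=> hs; apply: (sched_act (x := Drop a) hs) => //=.
  by move=> s hl hm; split=> //; [rewrite hl|move=> j; case: eqP => [->|]].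
by move=> j; rewrite mulr0; case: ifP.
Qed.

(** At this scale a budget is [2 * cap], so four trips of one [cap] each amount to the factor 2. *)
Lemma sched_feasible out a e :
  sched out a (AtVertex (start a)) (LiesAt (AtVertex (tgt I))) e ->
  (forall j, e j <= 4 * cap j)%N ->
  exists acts : seq (action (nv I) (na I) (nat * nat)),
     [/\ out = 1%N :: encode_schedule acts, all (@positive_dens _ _) acts &
         feasible (fun i => 2%:R * ratr (budget i)) (real_acts acts)].
Proof.
move=> [acts [h1 h2 h3 h4 h5]] he; exists acts; split=> //.
split=> // i; last by have [-> _] := h5 i; case: eqP => // ->.
have [_ h] := h5 i; rewrite -(ler_pM2l (scale_gt0 sc R)).
apply: (le_trans h); apply: (@le_trans _ _ (4 * cap i)%:R); first by rewrite ler_nat.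
by rewrite natrM (capE sc) /scale; lra.
Qed.

Lemma frac_val_opp (num den : nat) : (num <= den)%N -> (0 < den)%N ->
  frac_val R ((den - num)%N, den) = 1 - frac_val R (num, den).
Proof.
move=> h h0; rewrite /frac_val natrB // mulrBl divff //.
by rewrite pnatr_eq0 -lt0n.
Qed.

Lemma edge_point_sym (u v : 'I_(nv I)) (x : R) : u != v -> 
  edge_point v u (1 - x) = edge_point u v x.
Proof.
move=> huv; rewrite /edge_point.
have -> : (1 - x == 0) = (x == 1) by rewrite subr_eq0 eq_sym.
have -> : (1 - x == 1) = (x == 0).
  by rewrite -subr_eq0 addrAC subrr add0r oppr_eq0.
case: eqP => [->|x1]; first by rewrite oner_eq0.
case: eqP => // x0; have e : 1 - (1 - x) = x by ring.
by rewrite e; case: (ltngtP u v) => // /val_inj /eqP; rewrite (negPf huv).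
Qed.

End Building.

(** * The algorithm *)

(* Arrays: 0 input, 1 common denominator, 2 infinity, 3 half budgets, 4 lengths,
   5 and 6 Bellman-Ford costs and hops in the graph, 7 distances, 8 link costs,
   9 and 10 handover edges, 11 and 12 Bellman-Ford costs and hops among agents.
   The arrays from 13 on are used as scalar variables. *)

Definition inp (c : nat) : expr := Get 0 (Cst c).
Definition add (e1 e2 : expr) : expr := Bin Add e1 e2.
Definition sub (e1 e2 : expr) : expr := Bin Defs.Sub e1 e2.
Definition mul (e1 e2 : expr) : expr := Bin Mul e1 e2.
(** Comparisons by truncated subtraction, where nonzero means true. *)
Definition le (e1 e2 : expr) : expr := sub (Cst 1) (sub e1 e2).
Definition lt (e1 e2 : expr) : expr := sub e2 e1.
Definition neq (e1 e2 : expr) : expr := add (sub e1 e2) (sub e2 e1).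
(** Row-major index. The row length is an input number and stands on the right, as [tame]
    requires. *)
Definition cell (c : nat) (e1 e2 : expr) : expr := add (mul e1 (inp c)) e2.
Definition set_var (a : nat) (e : expr) : prog := PStore a (Cst 0) e.
Definition block : seq prog -> prog := foldr PSeq PSkip.
Definition when (e : expr) (p : prog) : prog := PIf e p PSkip.

Lemma sem_block p ps s : sem (block (p :: ps)) s = sem (block ps) (sem p s).
Proof. by []. Qed.

Lemma sem_block1 p s : sem (block [:: p]) s = sem p s.
Proof. by []. Qed.

Lemma leE a b : (1 - (a - b) != 0) = (a <= b). Proof. by lia. Qed.
Lemma ltE a b : (b - a != 0) = (a < b). Proof. by lia. Qed.
Lemma neqE a b : ((a - b) + (b - a) != 0) = (a != b). Proof. by lia. Qed.

Lemma flat_inj N r v r' v' : v < N -> v' < N ->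
  (r * N + v == r' * N + v') = (r == r') && (v == v').
Proof.
move=> hv hv'; apply/eqP/andP => [h|[/eqP-> /eqP->]//].
have N0 : 0 < N by lia.
have := congr1 (divn^~ N) h; rewrite !divnMDl // !divn_small // !addn0 => ->.
by have := congr1 (modn^~ N) h; rewrite !modnMDl !modn_small // => ->.
Qed.

(** ** Bellman-Ford tables *)

(* The instance [o = true] works on the graph of agents, and [o = false] on the
   input graph. *)
Definition bound (o : bool) : nat := if o then 1 else 0.
Definition arr_w (o : bool) : nat := if o then 8 else 4.
Definition arr_f (o : bool) : nat := if o then 11 else 5.
Definition arr_x (o : bool) : nat := if o then 12 else 6.

(** Variable 23 holds the best cost and 24 the hop. The hop starts as the vertex itself, meaning no
    move, and changes only on a strict improvement. *)
Definition relax (o : bool) : prog :=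
  let via u := add (Get (arr_w o) (cell (bound o) (var 21) u))
                   (Get (arr_f o) (cell (bound o) (var 20) u)) in
  block [:: set_var 23 (Get (arr_f o) (cell (bound o) (var 20) (var 21)));
            set_var 24 (var 21);
            PFor 22 (bound o)
              (when (lt (via (var 22)) (var 23))
                 (block [:: set_var 23 (via (var 22)); set_var 24 (var 22)]))].

Definition bellman (o : bool) : prog :=
  PFor 20 (bound o)
    (PFor 21 (bound o)
       (block [:: relax o;
                  PStore (arr_f o)
                    (cell (bound o) (add (var 20) (Cst 1)) (var 21)) (var 23);
                  PStore (arr_x o)
                    (cell (bound o) (add (var 20) (Cst 1)) (var 21)) (var 24)])).

Lemma sem_relax o s N w f r v :
  s.1 0 (bound o) = N -> s.1 20 0 = r -> s.1 21 0 = v -> v < N ->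
  (forall u, u < N -> s.1 (arr_w o) (v * N + u) = w u) ->
  (forall u, u < N -> s.1 (arr_f o) (r * N + u) = f u) ->
  let b := (sem (relax o) s).1 23 0 in
  let x := (sem (relax o) s).1 24 0 in
  b = min_upto (f v) (fun u => w u + f u) N /\
  (x = v /\ b = f v \/ [/\ x < N, b = w x + f x & b < f v]).
Proof.
move=> hN hr hv vN hw hf.
rewrite /relax !sem_block; set p := when _ _; set s1 := sem _ (sem _ s).
pose Inv i (s' : config) := let b := s'.1 23 0 in let x := s'.1 24 0 in
  b = min_upto (f v) (fun u => w u + f u) i /\
  (x = v /\ b = f v \/ [/\ x < N, b = w x + f x & b < f v]).
have hN1 : s1.1 0 (bound o) = N by [].
suff : Inv (s1.1 0 (bound o)) (sem (PFor 22 (bound o) p) s1) by rewrite hN1.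
apply: sem_for => //; first by rewrite /Inv /= /set_mem /= hr hv hN hf //; split; [|left].
rewrite hN1 => i s' iN hi fr; rewrite /Inv.
have e21 : s'.1 21 0 = v by rewrite fr.
have e20 : s'.1 20 0 = r by rewrite fr.
have eN : s'.1 0 (bound o) = N by rewrite fr.
have ew : s'.1 (arr_w o) (v * N + i) = w i by rewrite fr; case: (o) hw => /(_ i iN).
have ef : s'.1 (arr_f o) (r * N + i) = f i by rewrite fr; case: (o) hf => /(_ i iN).
rewrite {1 2}/p /= e20 e21 hi eN ew ef ltE.
rewrite /set_mem; case: ifP => h /= [e1 e2]; rewrite ?hi.
  split; first by rewrite -e1; move: h; rewrite /minn; case: ltngtP.
  right; split=> //; apply: (leq_trans h).
  by rewrite e1 min_upto_le.
split=> //; rewrite -e1; apply/esym/minn_idPl.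
by rewrite leqNgt h.
Qed.

Lemma sem_bellman o s N w f0 :
  s.1 0 (bound o) = N ->
  (forall v u, v < N -> u < N -> s.1 (arr_w o) (v * N + u) = w v u) ->
  (forall v, v < N -> s.1 (arr_f o) v = f0 v) ->
  let m := (sem (bellman o) s).1 in
  let f := bf w N f0 in
  (forall r v, r <= N -> v < N -> m (arr_f o) (r * N + v) = f r v) /\
  (forall r v, r < N -> v < N -> let x := m (arr_x o) (r.+1 * N + v) in
     x = v /\ f r.+1 v = f r v \/
     [/\ x < N, f r.+1 v = w v x + f r x & f r.+1 v < f r v]).
Proof.
move=> hN hw hf0 m f; rewrite /m /bellman.
set body := block _.
(* Rows up to [R] are complete, and [V] entries of the next row are filled. A full next row is the
   same as [V = 0] one row further. *)
pose Inv2 (R V : nat) (s' : config) :=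
  (forall r v, r <= R -> v < N -> s'.1 (arr_f o) (r * N + v) = f r v) /\
  (forall v, v < V -> s'.1 (arr_f o) (R.+1 * N + v) = f R.+1 v) /\
  (forall r v, v < N -> r < R \/ r = R /\ v < V ->
     let x := s'.1 (arr_x o) (r.+1 * N + v) in
     x = v /\ f r.+1 v = f r v \/
     [/\ x < N, f r.+1 v = w v x + f r x & f r.+1 v < f r v]).
suff [h1 [_ h2]] : Inv2 (s.1 0 (bound o)) 0 (sem (PFor 20 (bound o) (PFor 21 (bound o) body)) s).
  by rewrite hN in h1 h2; split=> // r v hr hv; apply: h2 => //; left.
apply: (sem_for (Inv := fun R => Inv2 R 0)); first by rewrite /body; case: (o).
  split=> [[|r] v //= _ hv|]; last by split=> // r v _ [|[]].
  rewrite mul0n add0n.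
  by case: (o) hf0 => /(_ v hv).
rewrite hN => R s1 RN hR fr1 hI.
suff hI' : Inv2 R (s1.1 0 (bound o)) (sem (PFor 21 (bound o) body) s1).
  have eN : s1.1 0 (bound o) = N by rewrite fr1 ?hN // /body; case: (o).
  rewrite eN in hI'; case: hI' => [h1 [h2 h3]].
  split; [move=> r v|split; [by []|move=> r v hv [hr|[_]]; last by rewrite ltn0]].
    rewrite leq_eqVlt => /orP[/eqP->|hr] hv.
      by have := h2 v hv; case: (o).
    by have := h1 r v hr hv; case: (o).
  have {}hr : r < R \/ r = R /\ v < N.
    by move: hr; rewrite ltnS leq_eqVlt => /orP[/eqP->|]; [right|left].
  by have := h3 r v hv hr; case: (o).
have eN : s1.1 0 (bound o) = N by rewrite fr1 ?hN // /body; case: (o).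
apply: (sem_for (Inv := Inv2 R)); first by rewrite /body; case: (o).
  case: hI => h1 [h2 h3]; split=> [r v hr hv|]; last split=> // r v hv hr.
    by have := h1 r v hr hv; case: (o).
  by have := h3 r v hv hr; case: (o).
rewrite eN => V s2 VN hV fr2 [h1 [h2 h3]].
have e2N : s2.1 0 (bound o) = N by rewrite fr2 ?eN // /body; case: (o).
have e2R : s2.1 20 0 = R by rewrite fr2 ?hR // /body; case: (o).
have e2w u : u < N -> s2.1 (arr_w o) (V * N + u) = w V u.
  move=> hu; rewrite fr2; last by rewrite /body; case: (o).
  by rewrite fr1 ?hw // /body; case: (o).
have e2f u : u < N -> s2.1 (arr_f o) (R * N + u) = f R u by move=> hu; apply: h1.
have [hb hx] := sem_relax e2N e2R hV VN e2w e2f.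
rewrite /body !sem_block; set s3 := sem (relax o) s2 in hb hx *.
have fr3 a j : a \notin [:: 22; 23; 24] -> s3.1 a j = s2.1 a j.
  move=> ha; rewrite /s3 sem_frame //; apply: contra ha.
  by rewrite /relax /= !inE; case: (a == 22); case: (a == 23); case: (a == 24).
set b := s3.1 23 0 in hb hx *; set x := s3.1 24 0 in hx *.
have eb : b = f R.+1 V by rewrite hb.
have g20 : s3.1 20 0 = R by rewrite fr3.
have g21 : s3.1 21 0 = V by rewrite fr3.
have gN : s3.1 0 (bound o) = N by rewrite fr3.
have gf i : s3.1 (arr_f o) i = s2.1 (arr_f o) i by rewrite fr3 //; case: (o).
have gx i : s3.1 (arr_x o) i = s2.1 (arr_x o) i by rewrite fr3 //; case: (o).
set s4 := sem _ (sem _ s3).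
have k1 j : s4.1 (arr_f o) j = if j == R.+1 * N + V then b else s2.1 (arr_f o) j.
  move: gN (gf j); rewrite /s4 /b; case: (o) => /= gN' gf';
    by rewrite /set_mem /= g20 g21 gN' gf' addn1.
have k2 j : s4.1 (arr_x o) j = if j == R.+1 * N + V then x else s2.1 (arr_x o) j.
  move: gN (gx j); rewrite /s4 /x; case: (o) => /= gN' gx';
    by rewrite /set_mem /= g20 g21 gN' gx' addn1.
have c1 j : (set_counter 21 V.+1 s4).1 (arr_f o) j = s4.1 (arr_f o) j by case: (o).
have c2 j : (set_counter 21 V.+1 s4).1 (arr_x o) j = s4.1 (arr_x o) j by case: (o).
split=> [r v hr hv|]; last split=> [v|r v hv hr].
- by rewrite c1 k1 flat_inj // (ltn_eqF (_ : r < R.+1)) //= h1.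
- rewrite ltnS leq_eqVlt c1 k1 => /orP[/eqP->|hv]; first by rewrite eqxx.
  by rewrite flat_inj ?(ltn_trans hv) // (ltn_eqF hv) andbF h2.
rewrite c2 k2 flat_inj // eqSS.
case: (eqVneq r R) => [er|nr] /=; last first.
  by apply: h3 => //; case: hr => [|[e _]]; [left|rewrite e eqxx in nr].
case: (eqVneq v V) => [ev|nv] /=; last first.
  apply: h3 => //; rewrite er; right; split=> //.
  by case: hr => [|[_]]; [rewrite er ltnn|rewrite ltnS leq_eqVlt (negPf nv)].
by rewrite er ev -eb.
Qed.

(** ** Scaling *)

Lemma sem_forN (N : nat) (Inv : nat -> config -> Prop) x c p s :
    s.1 0 c = N -> x \notin writes p ->
    Inv 0 (set_counter x 0 s) ->
    (forall i s', i < N -> s'.1 x 0 = i ->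
       (forall a j, a \notin x :: writes p -> s'.1 a j = s.1 a j) ->
       Inv i s' -> Inv i.+1 (set_counter x i.+1 (sem p s'))) ->
  Inv N (sem (PFor x c p) s).
Proof. by move=> <-; apply: sem_for. Qed.

Definition edge_num_at (u v : expr) : expr :=
  Get 0 (add (Cst 4) (mul (cell 0 u v) (Cst 2))).
Definition edge_den_at (u v : expr) : expr :=
  Get 0 (add (add (Cst 4) (mul (cell 0 u v) (Cst 2))) (Cst 1)).
Definition agent_base (i : expr) : expr :=
  add (add (Cst 4) (mul (mul (inp 0) (inp 0)) (Cst 2))) (mul i (Cst 3)).
Definition home_at (i : expr) : expr := Get 0 (agent_base i).
Definition budget_num_at (i : expr) : expr := Get 0 (add (agent_base i) (Cst 1)).
Definition budget_den_at (i : expr) : expr := Get 0 (add (agent_base i) (Cst 2)).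

(** The plain product of all denominators: no gcd is computed, and each factor is an input number,
    so its bit length stays polynomial. *)
Definition common_den : prog :=
  block [:: set_var 1 (Cst 1);
            PFor 20 0 (PFor 21 0
              (when (edge_den_at (var 20) (var 21))
                 (set_var 1 (mul (var 1) (edge_den_at (var 20) (var 21))))));
            PFor 20 1 (set_var 1 (mul (var 1) (budget_den_at (var 20))))].

(** Infinity is one plus twice the sum of the caps, hence above the sum of any two caps. *)
Definition caps : prog :=
  block [:: set_var 2 (Cst 1);
            PFor 20 1 (block
              [:: PStore 3 (var 20)
                    (mul (Bin Div (var 1) (budget_den_at (var 20)))
                         (budget_num_at (var 20)));
                  set_var 2 (add (var 2) (mul (Get 3 (var 20)) (Cst 2)))])].

Definition lens : prog :=
  PFor 20 0 (PFor 21 0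
    (PIf (neq (var 20) (var 21))
       (PIf (edge_den_at (var 20) (var 21))
          (PStore 4 (cell 0 (var 20) (var 21))
             (mul (mul (Bin Div (var 1) (edge_den_at (var 20) (var 21)))
                       (edge_num_at (var 20) (var 21))) (Cst 2)))
          (PStore 4 (cell 0 (var 20) (var 21)) (var 2)))
       (PStore 4 (cell 0 (var 20) (var 21)) (Cst 0)))).

Section Tables.
Variable I : delivery.
Local Notation n := (nv I).
Local Notation k := (na I).

Definition reads_input (s : config) : Prop := forall i, s.1 0 i = input_nth I i.

Lemma reads_input_sem p s : wf p -> reads_input s -> reads_input (sem p s).
Proof. by move=> wp hs i; rewrite sem_frame ?wf_writes. Qed.

Lemma reads_input_eq s s' : (forall i, s'.1 0 i = s.1 0 i) -> reads_input s -> reads_input s'.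
Proof. by move=> h hs i; rewrite h. Qed.

Lemma reads_input_nv s : reads_input s -> s.1 0 0 = n. Proof. exact. Qed.

Lemma budget_den_gt0 i : i < k -> 0 < budget_den I i.
Proof.
by move=> hi; rewrite -[i]/(val (Ordinal hi)) budget_denE absz_gt0 denq_neq0.
Qed.

Lemma sem_common_den s : reads_input s ->
  let Q := (sem common_den s).1 1 0 in
  [/\ 0 < Q,
      forall u v, u < n -> v < n -> edge_den I u v != 0 -> edge_den I u v %| Q &
      forall i, i < k -> budget_den I i %| Q].
Proof.
move=> hs; rewrite /common_den 3!sem_block; set s1 := sem (set_var 1 _) s.
set p1 := PFor 20 0 _; set p2 := PFor 20 1 _.
have r1 : reads_input s1 by apply: reads_input_sem.
pose Inv1 U V (s' : config) := 0 < s'.1 1 0 /\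
  forall u v, v < n -> u < U \/ u = U /\ v < V -> edge_den I u v != 0 ->
    edge_den I u v %| s'.1 1 0.
have [Q1 d1] : Inv1 n 0 (sem p1 s1).
  apply: (sem_forN (Inv := fun U => Inv1 U 0)) => //.
    by split=> // u v _ [|[]].
  move=> U s2 hU h20 fr2 I2.
  have r2 : reads_input s2 by apply: reads_input_eq r1 => i; rewrite fr2.
  suff [q3 d3] : Inv1 U n (sem (PFor 21 0 (when (edge_den_at (var 20) (var 21))
       (set_var 1 (mul (var 1) (edge_den_at (var 20) (var 21)))))) s2).
    split=> // u v hv [hu|[]]; last by rewrite ltn0.
    by apply: d3 => //; move: hu; rewrite ltnS leq_eqVlt => /orP[/eqP|]; [right|left].
  apply: (sem_forN (Inv := Inv1 U)) => //.
  move=> V s3 hV h21 fr3 [q3 d3].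
  have r3 : reads_input s3 by apply: reads_input_eq r2 => i; rewrite fr3.
  have e3 : s3.1 0 (4 + (s3.1 20 0 * s3.1 0 0 + s3.1 21 0) * 2 + 1) = edge_den I U V.
    by rewrite r3 h21 fr3 // h20 (reads_input_nv r3).
  rewrite /Inv1 /= e3; case: ifP => hd /=; rewrite /set_mem /= ?e3.
    split; first by rewrite muln_gt0 q3 lt0n.
    move=> u v hv hu hd'; have [euv|nuv] := boolP ((u == U) && (v == V)).
      by have /andP[/eqP-> /eqP->] := euv; apply: dvdn_mull.
    apply: dvdn_mulr; apply: d3 => //; case: hu => [|[eu]]; first by left.
    rewrite ltnS leq_eqVlt => /orP[ev|]; [|by right].
    by rewrite eu ev eqxx in nuv.
  split=> // u v hv hu hd'; apply: d3 => //; case: hu => [|[eu]]; first by left.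
  rewrite ltnS leq_eqVlt => /orP[/eqP ev|]; [|by right].
  by rewrite eu ev hd in hd'.
have r2 : reads_input (sem p1 s1) by apply: reads_input_sem.
pose Inv2 i (s' : config) := [/\ 0 < s'.1 1 0, (sem p1 s1).1 1 0 %| s'.1 1 0 &
  forall j, j < i -> budget_den I j %| s'.1 1 0].
have [Q2 d2 d3] : Inv2 k (sem p2 (sem p1 s1)).
  apply: (sem_forN (Inv := Inv2)) => //.
  move=> i s2 hi h20 fr2 [q2 d2 d3].
  have r3 : reads_input s2 by apply: reads_input_eq r2 => j; rewrite fr2.
  have e3 : s2.1 0 (4 + s2.1 0 0 * s2.1 0 0 * 2 + s2.1 20 0 * 3 + 2) = budget_den I i.
    by rewrite r3 h20 (reads_input_nv r3).
  rewrite /Inv2 /= /set_mem /= e3; split.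
  - by rewrite muln_gt0 q2 budget_den_gt0.
  - exact: dvdn_mulr.
  - move=> j; rewrite ltnS leq_eqVlt => /orP[/eqP->|/d3 h]; first exact: dvdn_mull.
    exact: dvdn_mulr.
split=> // u v hu hv hd; apply: dvdn_trans d2; apply: d1 => //; by left.
Qed.

Lemma sem_caps s Q : reads_input s -> s.1 1 0 = Q ->
  let s' := sem caps s in
  forall i, i < k -> s'.1 3 i = cap I Q i /\ cap I Q i * 2 < s'.1 2 0.
Proof.
move=> hs hQ; rewrite /caps 2!sem_block; set s1 := sem (set_var 2 _) s.
have r1 : reads_input s1 by apply: reads_input_sem.
pose Inv i (s' : config) := 0 < s'.1 2 0 /\
  forall j, j < i -> s'.1 3 j = cap I Q j /\ cap I Q j * 2 < s'.1 2 0.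
suff [_ h] : Inv k (sem (PFor 20 1 (block
   [:: PStore 3 (var 20) (mul (Bin Div (var 1) (budget_den_at (var 20)))
          (budget_num_at (var 20)));
       set_var 2 (add (var 2) (mul (Get 3 (var 20)) (Cst 2)))])) s1) by [].
apply: (sem_forN (Inv := Inv)) => //.
move=> i s2 hi h20 fr2 [q2 d2].
have r3 : reads_input s2 by apply: reads_input_eq r1 => j; rewrite fr2.
have e3 : s2.1 0 (4 + s2.1 0 0 * s2.1 0 0 * 2 + s2.1 20 0 * 3 + 2) = budget_den I i.
  by rewrite r3 h20 (reads_input_nv r3).
have e4 : s2.1 0 (4 + s2.1 0 0 * s2.1 0 0 * 2 + s2.1 20 0 * 3 + 1) = budget_num I i.
  by rewrite r3 h20 (reads_input_nv r3).
have e5 : s2.1 1 0 = Q by rewrite fr2.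
rewrite /Inv /= /set_mem /= e3 e4 e5 eqxx h20 -/(cap I Q i); split; first by rewrite addn_gt0 q2.
move=> j; rewrite ltnS leq_eqVlt => /orP[/eqP->|hj]; first by rewrite eqxx; split=> //; lia.
by rewrite (ltn_eqF hj); have [-> ?] := d2 j hj; split=> //; lia.
Qed.

Lemma sem_lens s Q inf : reads_input s -> s.1 1 0 = Q -> s.1 2 0 = inf ->
  forall u v, u < n -> v < n -> (sem lens s).1 4 (u * n + v) = len I Q inf u v.
Proof.
move=> hs hQ hi; rewrite /lens; set body := PIf _ _ _.
pose Inv U V (s' : config) := forall u v, v < n -> u < U \/ u = U /\ v < V ->
    s'.1 4 (u * n + v) = len I Q inf u v.
suff h : Inv n 0 (sem (PFor 20 0 (PFor 21 0 body)) s) by move=> u v hu hv; apply: h => //; left.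
apply: (sem_forN (Inv := fun U => Inv U 0)) => //.
  by move=> u v _ [|[]].
move=> U s2 hU h20 fr2 I2.
have r2 : reads_input s2 by apply: reads_input_eq hs => i; rewrite fr2.
suff d3 : Inv U n (sem (PFor 21 0 body) s2).
  move=> u v hv [hu|[]]; last by rewrite ltn0.
  by apply: d3 => //; move: hu; rewrite ltnS leq_eqVlt => /orP[/eqP|]; [right|left].
apply: (sem_forN (Inv := Inv U)) => //.
move=> V s3 hV h21 fr3 d3 u v hv hu.
have r3 : reads_input s3 by apply: reads_input_eq r2 => i; rewrite fr3.
have e20 : s3.1 20 0 = U by rewrite fr3.
have e3 : s3.1 0 (4 + (U * n + V) * 2 + 1) = edge_den I U V by rewrite r3.
have e4 : s3.1 0 (4 + (U * n + V) * 2) = edge_num I U V by rewrite r3.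
have e5 : s3.1 1 0 = Q by rewrite fr3 ?fr2.
have e6 : s3.1 2 0 = inf by rewrite fr3 ?fr2.
have -> : (set_counter 21 V.+1 (sem body s3)).1 4 (u * n + v) =
    (if u * n + v == U * n + V then len I Q inf U V else s3.1 4 (u * n + v)).
  rewrite /body /= h21 e20 (reads_input_nv r3) e3 e4 e5 e6 neqE /len.
  case: (eqVneq U V) => [<-|_] //=.
  by case: (eqVneq (edge_den I U V) 0).
rewrite flat_inj //; case: (eqVneq u U) => [eu|nu] /=; last first.
  by apply: d3 => //; case: hu => [|[e _]]; [left|rewrite e eqxx in nu].
case: (eqVneq v V) => [ev|nv] /=; first by rewrite eu ev.
apply: d3 => //; rewrite eu; right; split=> //.
by case: hu => [|[_]]; [rewrite eu ltnn|rewrite ltnS leq_eqVlt (negPf nv)].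
Qed.

End Tables.

(** ** Distances and links *)

Definition init_target : prog :=
  PFor 33 0 (PIf (neq (var 33) (var 32)) (PStore 5 (var 33) (var 2))
                                         (PStore 5 (var 33) (Cst 0))).

Definition search : prog := block [:: init_target; bellman false].

(** Each search overwrites the same table, so its last row is copied to array 7 before the next
    target. *)
Definition distances : prog :=
  PFor 34 0 (block
    [:: set_var 32 (var 34); search;
        PFor 33 0 (PStore 7 (cell 0 (var 34) (var 33))
                            (Get 5 (cell 0 (inp 0) (var 33))))]).

Definition cap_at (i : expr) : expr := Get 3 i.
Definition dist_at (i v : expr) : expr := Get 7 (cell 0 (home_at i) v).
Definition len_at (u v : expr) : expr := Get 4 (cell 0 u v).

(** A link costs 0 and a missing link 1, just as in [last_agents] for the target. A table value is
    then 0 exactly when true links lead to an agent that can reach t. *)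
Definition links : prog :=
  PFor 20 1 (PFor 21 1 (block
    [:: PStore 8 (cell 1 (var 20) (var 21)) (Cst 1);
        PFor 22 0 (PFor 23 0
          (when (le (dist_at (var 20) (var 22)) (cap_at (var 20)))
          (when (le (dist_at (var 21) (var 23)) (cap_at (var 21)))
          (when (le (add (add (dist_at (var 20) (var 22))
                              (len_at (var 22) (var 23)))
                         (dist_at (var 21) (var 23)))
                    (add (cap_at (var 20)) (cap_at (var 21))))
             (block [:: PStore 8 (cell 1 (var 20) (var 21)) (Cst 0);
                        PStore 9 (cell 1 (var 20) (var 21)) (var 22);
                        PStore 10 (cell 1 (var 20) (var 21)) (var 23)])))))])).

Definition last_agents : prog :=
  PFor 20 1 (PIf (le (dist_at (var 20) (inp 3)) (cap_at (var 20)))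
               (PStore 11 (var 20) (Cst 0)) (PStore 11 (var 20) (Cst 1))).

Definition find_first : prog :=
  block [:: set_var 13 (Cst 0);
            PFor 20 1
              (when (le (dist_at (var 20) (inp 2)) (cap_at (var 20)))
              (when (le (Get 11 (cell 1 (inp 1) (var 20))) (Cst 0))
                 (block [:: set_var 13 (Cst 1); set_var 14 (var 20)])))].

Section Distances.
Variables (I : delivery) (Q inf : nat).
Local Notation n := (nv I).
Local Notation k := (na I).
Local Notation len := (len I Q inf).
Local Notation cap := (cap I Q).
Local Notation d := (d I Q inf).

Record weighted (s : config) : Prop := Weighted {
  weighted_input : reads_input I s;
  weighted_inf : s.1 2 0 = inf;
  weighted_cap : forall i, i < k -> s.1 3 i = cap i;
  weighted_len : forall u v, u < n -> v < n -> s.1 4 (u * n + v) = len u v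
}.

Lemma weighted_eq s s' :
  (forall a j, a \in [:: 0; 2; 3; 4] -> s'.1 a j = s.1 a j) ->
  weighted s -> weighted s'.
Proof.
move=> h [h1 h2 h3 h4]; split.
- by move=> i; rewrite h.
- by rewrite h.
- by move=> i hi; rewrite h ?h3.
- by move=> u v hu hv; rewrite h ?h4.
Qed.

Lemma weighted_sem p s : all (fun a => a \notin writes p) [:: 0; 2; 3; 4] ->
  weighted s -> weighted (sem p s).
Proof. by move=> /allP h; apply: weighted_eq => a j /h; apply: sem_frame. Qed.

Lemma sem_search s q : weighted s -> s.1 32 0 = q ->
  let m := (sem search s).1 in
  let f := bf len n (only_at inf q) in
  (forall r v, r <= n -> v < n -> m 5 (r * n + v) = f r v) /\
  (forall r v, r < n -> v < n -> let x := m 6 (r.+1 * n + v) in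
     x = v /\ f r.+1 v = f r v \/
     [/\ x < n, f r.+1 v = len v x + f r x & f r.+1 v < f r v]).
Proof.
move=> ws hq; rewrite /search 2!sem_block.
have w1 : weighted (sem init_target s) by apply: weighted_sem.
apply: (@sem_bellman false (sem init_target s)); first exact: weighted_input w1 0.
  by move=> v u hv hu; apply: weighted_len.
suff h : forall v, v < n -> (sem init_target s).1 5 v = only_at inf q v by [].
apply: (sem_forN (Inv := fun i s' => forall v, v < i -> s'.1 5 v = only_at inf q v)) => //.
  exact: weighted_input ws 0.
move=> i s' hi h33 fr hI v; rewrite ltnS leq_eqVlt.
have e2 : s'.1 2 0 = inf by rewrite fr // weighted_inf.
have e32 : s'.1 32 0 = q by rewrite fr.
rewrite /= h33 e32 neqE e2 /set_mem /only_at => /orP[/eqP->|hv].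
  by case: (eqVneq i q) => _ /=; rewrite eqxx.
rewrite -/(only_at inf q v) -hI //.
by case: (eqVneq i q) => _ /=; rewrite (ltn_eqF hv).
Qed.

Lemma sem_distances s : weighted s -> forall q v, q < n -> v < n ->
  (sem distances s).1 7 (q * n + v) = d q v.
Proof.
move=> ws; have hn := weighted_input ws 0; rewrite /distances; set body := block _.
pose Inv1 q' (s' : config) := forall q v, q < q' -> v < n -> s'.1 7 (q * n + v) = d q v.
suff h : Inv1 n (sem (PFor 34 0 body) s) by [].
apply: (sem_forN (Inv := Inv1)) => //.
move=> q' s1 hq' h34 fr1 h1.
have w1 : weighted s1.
  apply: weighted_eq ws => a j; rewrite !inE => /or4P[] /eqP->; exact: fr1.
rewrite /body 2!sem_block.
set s2 := sem (set_var 32 _) s1.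
have w2 : weighted s2 by apply: weighted_sem.
have e32 : s2.1 32 0 = q' by rewrite -h34.
have [hF _] := sem_search w2 e32.
set s3 := sem search s2 in hF *.
have w3 : weighted s3 by apply: weighted_sem.
have e34 : s3.1 34 0 = q' by rewrite /s3 sem_frame // -h34.
have e7 j : s3.1 7 j = s1.1 7 j by rewrite /s3 sem_frame.
rewrite sem_block; set p := PFor 33 0 _.
pose Inv2 i (s' : config) := forall q v, v < n -> q < q' \/ q = q' /\ v < i ->
    s'.1 7 (q * n + v) = d q v.
suff h : Inv2 n (sem p s3).
  move=> q v; rewrite ltnS leq_eqVlt => hq hv; apply: h => //.
  by case/orP: hq => [/eqP|]; [right|left].
apply: (sem_forN (Inv := Inv2)) => //; first exact: weighted_input w3 0.
  by move=> q v hv [hq|[]] //; rewrite -h1 // -e7.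
move=> i s4 hi h33 fr4 h4 q v hv hq.
have eN : s4.1 0 0 = n by rewrite fr4 // (weighted_input w3).
have e34' : s4.1 34 0 = q' by rewrite fr4.
rewrite /= /set_mem /= h33 eN e34' flat_inj // fr4 // hF //.
case: (eqVneq q q') => [eq|nq] /=; last first.
  by apply: h4 => //; case: hq => [|[e _]]; [left|rewrite e eqxx in nq].
case: (eqVneq v i) => [ev|nv] /=; first by rewrite eq ev.
apply: h4 => //; rewrite eq; right; split=> //.
by case: hq => [|[_]]; [rewrite eq ltnn|rewrite ltnS leq_eqVlt (negPf nv)].
Qed.

Record measured (s : config) : Prop := Measured {
  measured_weighted : weighted s;
  measured_dist : forall q v, q < n -> v < n -> s.1 7 (q * n + v) = d q v
}.

Lemma measured_eq s s' :
  (forall a j, a \in [:: 0; 2; 3; 4; 7] -> s'.1 a j = s.1 a j) ->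
  measured s -> measured s'.
Proof.
move=> h [h1 h2]; split; last by move=> q v hq hv; rewrite h ?h2.
by apply: weighted_eq h1 => a j ha; apply: h; move: ha; rewrite !inE => /or4P[] ->; rewrite ?orbT.
Qed.

Lemma measured_sem p s : all (fun a => a \notin writes p) [:: 0; 2; 3; 4; 7] ->
  measured s -> measured (sem p s).
Proof. by move=> /allP h; apply: measured_eq => a j /h; apply: sem_frame. Qed.

Lemma home_lt i : i < k -> home I i < n.
Proof. by move=> hi; rewrite -[i]/(val (Ordinal hi)) homeE. Qed.

Lemma eval_dist s i v j w : measured s -> eval s.1 i = j -> eval s.1 v = w ->
  j < k -> w < n -> eval s.1 (dist_at i v) = d (home I j) w.
Proof.
move=> ms hi hv hj hw; have hr := weighted_input (measured_weighted ms).
by rewrite /= hi hv !hr -(measured_dist ms) ?home_lt.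
Qed.

(* What [links] stores about a pair of agents: a link cost, and the edge of a
   handover when the cost is 0. *)
Definition link_ok (i j c u v : nat) : Prop :=
  [/\ c = 0, u < n, v < n & handover I Q inf i j u v] \/
  c = 1 /\ ~ linked I Q inf i j.

Lemma sem_links s : measured s -> let m := (sem links s).1 in
  forall i j, i < k -> j < k ->
  link_ok i j (m 8 (i * k + j)) (m 9 (i * k + j)) (m 10 (i * k + j)).
Proof.
move=> ms; rewrite /links; set body := block _.
have hk s' : measured s' -> s'.1 0 1 = k by case=> [[h _ _ _] _]; apply: h.
have hn s' : measured s' -> s'.1 0 0 = n by case=> [[h _ _ _] _]; apply: h.
pose ok (s' : config) i j :=
  link_ok i j (s'.1 8 (i * k + j)) (s'.1 9 (i * k + j)) (s'.1 10 (i * k + j)).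
pose Inv3 a (s' : config) := forall i j, i < a -> j < k -> ok s' i j.
suff h : Inv3 k (sem (PFor 20 1 (PFor 21 1 body)) s) by [].
apply: (sem_forN (Inv := Inv3)) => //; first exact: hk.
move=> a s1 ha h20 fr1 h1.
have m1 : measured s1.
  by apply: measured_eq ms => b j; rewrite !inE => hb; apply: fr1; case/or4P: hb => [||| /orP[]] /eqP->.
pose Inv4 b (s' : config) := forall i j, j < k -> i < a \/ i = a /\ j < b -> ok s' i j.
suff h : Inv4 k (sem (PFor 21 1 body) s1).
  move=> i j; rewrite ltnS leq_eqVlt => hi hj; apply: h => //.
  by case/orP: hi => [/eqP|]; [right|left].
apply: (sem_forN (Inv := Inv4)) => //; first exact: hk.
  by move=> i j hj [hi|[]] //; apply: h1.
move=> b s2 hb h21 fr2 h2.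
have m2 : measured s2.
  by apply: measured_eq m1 => c j; rewrite !inE => hc; apply: fr2; case/or4P: hc => [||| /orP[]] /eqP->.
rewrite /body sem_block; set s3 := sem (PStore 8 _ _) s2.
have m3 : measured s3 by apply: measured_sem.
rewrite sem_block; set p := PFor 22 0 _.
have e20 : s2.1 20 0 = a by rewrite fr2.
pose other i j := i < k -> j < k -> (i == a) && (j == b) = false -> ok s2 i j.
(* Invariant of the search over u and v for one pair of agents: other cells are untouched, and this
   cell holds either a valid handover or a certificate that no scanned pair, those in [P], is
   one. *)
pose found (s' : config) (P : nat -> nat -> Prop) :=
  (forall c j, c \in [:: 8; 9; 10] -> j != a * k + b -> s'.1 c j = s2.1 c j) /\
  ([/\ s'.1 8 (a * k + b) = 0, s'.1 9 (a * k + b) < n, s'.1 10 (a * k + b) < n &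
     handover I Q inf a b (s'.1 9 (a * k + b)) (s'.1 10 (a * k + b))] \/
   s'.1 8 (a * k + b) = 1 /\
   forall u v, u < n -> v < n -> P u v -> ~~ handover I Q inf a b u v).
have found_ctr x i s' P : x \notin [:: 8; 9; 10] -> found s' P ->
    found (set_counter x i s') P.
  rewrite !inE !negb_or => /and3P[x8 x9 x10] [g1 g2].
  have e c j : c \in [:: 8; 9; 10] -> (set_counter x i s').1 c j = s'.1 c j.
    rewrite !inE /= /set_mem.
    by case/or3P => /eqP->; rewrite eq_sym ?(negPf x8) ?(negPf x9) ?(negPf x10).
  by split=> [c j hc hj|]; rewrite !e //; apply: g1.
suff [hoth hab] : found (sem p s3) (fun u v => u < n).
  move=> i j hj hi.
  have [/andP[/eqP-> /eqP->]|nij] := boolP ((i == a) && (j == b)).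
    case: hab => [|[h8 hno]]; first by left.
    right; split=> //; case=> u [v [hu hv huv]].
    by have := hno u v hu hv hu; rewrite huv.
  have nf : i * k + j != a * k + b by rewrite flat_inj.
  have hi' : i < a \/ i = a /\ j < b.
    case: hi => [|[ei]]; first by left.
    rewrite ltnS leq_eqVlt => /orP[ej|]; last by right.
    by rewrite ei ej eqxx in nij.
  have := h2 i j hj hi'; rewrite /ok.
  by rewrite -(hoth 8) // -(hoth 9) // -(hoth 10).
have f3 : found s3 (fun u v => u < 0).
  split=> [c j hc /negPf nf|]; rewrite /s3 /= /set_mem /= e20 h21 (hk _ m2) ?nf ?eqxx ?andbF //.
  by right; split.
apply: (sem_forN (Inv := fun U s' => found s' (fun u v => u < U))) => //.
- exact: hn.
- exact: found_ctr.
move=> U s4 hU h22 fr4 f4.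
have m4 : measured s4.
  by apply: measured_eq m3 => c j; rewrite !inE => hc; apply: fr4; case/or4P: hc => [||| /orP[]] /eqP->.
have found_ext s' (P P' : nat -> nat -> Prop) :
    (forall u v, v < n -> P' u v -> P u v) -> found s' P -> found s' P'.
  move=> hP [g1 g2]; split=> //; case: g2; first by left.
  by move=> [g3 g4]; right; split=> // u v hu hv /(hP _ _ hv); apply: g4.
set p2 := PFor 23 0 _.
suff h : found (sem p2 s4) (fun u v => u < U \/ u = U /\ v < n).
  apply: (found_ctr 22) => //; apply: (found_ext (sem p2 s4)) h => u v hv; rewrite ltnS leq_eqVlt.
  by case/orP => [/eqP|]; [right|left].
apply: (sem_forN (Inv := fun V s' => found s' (fun u v => u < U \/ u = U /\ v < V))) => //.
- exact: hn.
- by apply: (found_ctr 23) => //; apply: (found_ext s4) f4 => u v _ [|[]].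
move=> V s5 hV h23 fr5 [o5 f5]; apply: (found_ctr 23) => //.
have m5 : measured s5.
  by apply: measured_eq m4 => c j; rewrite !inE => hc; apply: fr5; case/or4P: hc => [||| /orP[]] /eqP->.
have g20 : s5.1 20 0 = a by rewrite fr5 ?fr4.
have g21 : s5.1 21 0 = b by rewrite fr5 ?fr4.
have g22 : s5.1 22 0 = U by rewrite fr5.
have hd1 := eval_dist (i := var 20) (v := var 22) m5 g20 g22 ha hU.
have hd2 := eval_dist (i := var 21) (v := var 23) m5 g21 h23 hb hV.
have hc1 : eval s5.1 (cap_at (var 20)) = cap a.
  by rewrite /= g20 (weighted_cap (measured_weighted m5)).
have hc2 : eval s5.1 (cap_at (var 21)) = cap b.
  by rewrite /= g21 (weighted_cap (measured_weighted m5)).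
have hl : eval s5.1 (len_at (var 22) (var 23)) = len U V.
  by rewrite /= g22 h23 (hn _ m5) (weighted_len (measured_weighted m5)).
set q := when _ _.
have -> : sem q s5 = if handover I Q inf a b U V then
    (set_mem (set_mem (set_mem s5.1 8 (a * k + b) 0) 9 (a * k + b) U) 10 (a * k + b) V, s5.2)
    else s5.
  rewrite /q /le /when; cbn [sem eval sub add binop_val].
  rewrite hd1 hc1 leE hd2 hc2 leE hl leE /handover.
  case: ifP => //= _; case: ifP => //= _; case: ifP => //= _.
  by rewrite /set_mem /= g20 g21 g22 h23 (hk _ m5).
case: ifP => hh; split.
- by move=> c j hc hj; rewrite /= /set_mem /= (negPf hj) !andbF; apply: o5.
- by left; rewrite /= /set_mem /= !eqxx.
- exact: o5.
case: f5 => [f5|[f5 g5]]; [by left|right; split=> // u v hu hv [hu'|[eu]]].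
  by apply: g5 => //; left.
rewrite ltnS leq_eqVlt => /orP[/eqP->|hv']; first by rewrite eu hh.
by apply: g5 => //; right.
Qed.

End Distances.

(** ** Writing the schedule *)

Definition emit_list (es : seq expr) : prog := block (map PEmit es).

(** Reads the hop in row n minus the round, so each round descends one row. A hop to the same vertex
    emits nothing. The last four numbers emitted are the fractions 0/1 and 1/1. *)
Definition walk_step : prog :=
  block [:: set_var 35 (Get 6 (cell 0 (sub (inp 0) (var 34)) (var 31)));
            when (neq (var 35) (var 31)) (block
              [:: emit_list [:: Cst 0; var 30; var 31; var 35;
                                Cst 0; Cst 1; Cst 1; Cst 1];
                  set_var 31 (var 35)])].

(** The search is run again for each walk, as only the hops of the latest target are in memory. *)
Definition walk : prog := block [:: search; PFor 34 0 walk_step].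

(* Agent [var 30] goes from home to the point at fraction [var 43 / var 44] of
   the edge from [var 41] to [var 42] (to [var 41] if both are equal), performs
   the operation [var 45] and goes back home. *)
Definition visit : prog :=
  block [:: set_var 31 (home_at (var 30)); set_var 32 (var 41); walk;
            when (neq (var 41) (var 42))
              (emit_list [:: Cst 0; var 30; var 41; var 42;
                             Cst 0; Cst 1; var 43; var 44]);
            emit_list [:: var 45; var 30];
            when (neq (var 41) (var 42))
              (emit_list [:: Cst 0; var 30; var 41; var 42;
                             var 43; var 44; Cst 0; Cst 1]);
            set_var 31 (var 41); set_var 32 (home_at (var 30)); walk].

(** The fraction is (cap - distance) / length. Replacing it by 1/1 when the whole edge is affordable
    keeps it at most 1 and also avoids a zero denominator on edges of length 0. *)
Definition prepare_drop : prog :=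
  block [:: set_var 41 (Get 9 (cell 1 (var 14) (var 51)));
            set_var 42 (Get 10 (cell 1 (var 14) (var 51)));
            set_var 43 (sub (cap_at (var 14)) (dist_at (var 14) (var 41)));
            set_var 44 (len_at (var 41) (var 42));
            when (le (var 44) (var 43))
              (block [:: set_var 43 (Cst 1); set_var 44 (Cst 1)]);
            set_var 45 (Cst 2); set_var 30 (var 14)].

(** The same point seen from the other end, where the receiver comes from. *)
Definition prepare_pick : prog :=
  block [:: set_var 43 (sub (var 44) (var 43));
            set_var 46 (var 41); set_var 41 (var 42); set_var 42 (var 46);
            set_var 45 (Cst 1); set_var 30 (var 51)].

Definition hand_over : prog :=
  block [:: prepare_drop; visit; prepare_pick; visit].

Definition visit_vertex (v : expr) (op : nat) : prog :=
  block [:: set_var 30 (var 14); set_var 41 v; set_var 42 v;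
            set_var 45 (Cst op); visit].

Definition chain : prog :=
  block [:: visit_vertex (inp 2) 1;
            PFor 50 1 (block
              [:: set_var 51 (Get 12 (cell 1 (sub (inp 1) (var 50)) (var 14)));
                  when (neq (var 51) (var 14))
                    (block [:: hand_over; set_var 14 (var 51)])]);
            visit_vertex (inp 3) 2].

Lemma sem_emit_list es s : sem (emit_list es) s = (s.1, s.2 ++ map (eval s.1) es).
Proof.
elim: es s => [|e es IH] [m out] /=; first by rewrite cats0.
by rewrite -[sem _ _]/(sem (emit_list es) _) IH /= cat_rcons.
Qed.

(* Simplifying [sem] on nested assignments duplicates the memory exponentially;
   rewriting with this lemma does not. *)
Lemma sem_set_var a e s b :
  (sem (set_var a e) s).1 b 0 = if b == a then eval s.1 e else s.1 b 0.
Proof. by rewrite /= /set_mem andbT. Qed.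

Lemma set_counterE x i s b j :
  (set_counter x i s).1 b j = if (b == x) && (j == 0) then i else s.1 b j.
Proof. by []. Qed.

Lemma eval_var m a : eval m (var a) = m a 0.
Proof. by []. Qed.

Lemma eval_sub m e1 e2 : eval m (sub e1 e2) = eval m e1 - eval m e2.
Proof. by []. Qed.

Lemma sem_when e p s : sem (when e p) s = if eval s.1 e != 0 then sem p s else s.
Proof. by []. Qed.

(** * Correctness of walks and visits *)

Section Emission.
Variables (I : delivery) (Q inf : nat).
Hypothesis sc : scaled I Q inf.
Variable R : realType.
Local Notation n := (nv I).
Local Notation k := (na I).
Local Notation len := (len I Q inf).
Local Notation cap := (cap I Q).
Local Notation d := (d I Q inf).
Local Notation sched := (@sched I Q R).

Lemma sem_walk s (a : 'I_k) (u q : 'I_n) m e :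
  weighted I Q inf s -> s.1 30 0 = a -> s.1 31 0 = u -> s.1 32 0 = q ->
  d q u < inf ->
  sched s.2 a (AtVertex u) m e ->
  sched (sem walk s).2 a (AtVertex q) m (spend e a (d q u)).
Proof.
move=> ws h30 h31 h32 hd hs; rewrite /walk sem_block sem_block1.
have [_ hX] := sem_search ws h32.
set s1 := sem search s in hX *.
have w1 : weighted I Q inf s1 by apply: weighted_sem.
have o1 : s1.2 = s.2 by rewrite /s1 sem_silent.
have f1 b j : b \notin writes search -> s1.1 b j = s.1 b j by apply: sem_frame.
set f := bf len n (only_at inf q) in hX *.
have fd : f n u = d q u by [].
(* The energy spent and the cost still predicted by row [n - y] always add up to [d q u]. *)
pose Inv y (s' : config) := exists v : 'I_n,
  [/\ s'.1 31 0 = v, f (n - y) v <= d q u &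
      sched s'.2 a (AtVertex v) m (spend e a (d q u - f (n - y) v))].
suff [v [_ hv hs']] : Inv n (sem (PFor 34 0 walk_step) s1).
  (* In row 0 every vertex except [q] costs [inf], so a value below [inf] means that the walk has
     arrived. *)
  rewrite subnn in hv hs'; have {}hv := leq_ltn_trans hv hd.
  have evq : v = q.
    by apply/val_inj/eqP; move: hv; rewrite /f /= /only_at; case: eqP => //; rewrite ltnn.
  have f0 : f 0 q = 0 by rewrite /f /= /only_at eqxx.
  by move: hs'; rewrite evq f0 subn0.
apply: (sem_forN (Inv := Inv)) => //; first exact: weighted_input w1 0.
  exists u; rewrite subn0 fd leqnn; split=> //=; first by rewrite /set_mem /= f1.
  by rewrite o1; apply: schedW hs => j; apply: leq_addr.
move=> y s2 hy h34 fr2 [v [g31 gv gs]].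
have w2 : weighted I Q inf s2.
  by apply: weighted_eq w1 => b j; rewrite !inE => hb; apply: fr2; case/or4P: hb => /eqP->.
have e30 : s2.1 30 0 = a by rewrite fr2 // f1.
have eN : s2.1 0 0 = n by apply: weighted_input w2 0.
have er : n - y = (n - y.+1).+1 by lia.
set r := n - y.+1 in er *.
have ex : s2.1 6 ((n - y) * n + v) = s1.1 6 (r.+1 * n + v) by rewrite fr2 // er.
have rn : r < n by lia.
rewrite er in gv gs.
have hx := hX r v rn (ltn_ord v); cbv zeta in hx; set x := s1.1 6 _ in hx ex.
rewrite /Inv; have -> : sem walk_step s2 =
    if x != v then (set_mem (set_mem s2.1 35 0 x) 31 0 x,
      s2.2 ++ [:: 0; a : nat; v : nat; x; 0; 1; 1; 1])
    else (set_mem s2.1 35 0 x, s2.2).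
  rewrite /walk_step 2!sem_block; set s' := sem (set_var 35 _) s2.
  have -> : s' = (set_mem s2.1 35 0 x, s2.2) by rewrite /s' /= h34 g31 eN ex.
  rewrite -[sem (block [::]) _]/(if eval (set_mem s2.1 35 0 x) (neq (var 35) (var 31)) != 0
    then _ else _) /= /set_mem /= g31 neqE.
  case: ifP => // _.
  by rewrite e30 -!cats1 -!catA.
case: eqVneq => [exv|nxv] /=.
  have efr : f r.+1 v = f r v.
    by case: hx => [[_ ->]//|[_ -> _]]; rewrite exv lenxx.
  by rewrite efr in gv gs; exists v; split.
case: hx => [[exv _]|[xn hf hlt]]; first by rewrite exv eqxx in nxv.
(* The hop is shorter than [inf], hence a genuine edge. *)
have la : len v x <= d q u by lia.
have hadj : adj v (Ordinal xn).
  by apply: (len_inf (inf := inf) (Q := Q)); [apply: leq_ltn_trans la hd|rewrite eq_sym].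
exists (Ordinal xn); split=> /=; rewrite -/r //; first by lia.
have := sched_edge sc hadj gs; apply: schedW => j.
by rewrite /spend /=; case: ifP => _; lia.
Qed.

Definition visit_loc (u v : 'I_n) (x : nat * nat) : location n R :=
  if u == v then AtVertex u else edge_point u v (frac_val R x).

Lemma home_dist_sym (p u : 'I_n) : d p u = d u p.
Proof. by apply: dist_sym => // x y; apply: len_sym. Qed.

(** [c] bounds the part of the edge that is walked: [num * len u v <= c * den] is that bound cleared
    of its denominator. It is paid once each way. *)
Lemma sem_visit s (a : 'I_k) (u v : 'I_n) num den op m m' e c :
  weighted I Q inf s -> s.1 30 0 = a -> s.1 41 0 = u -> s.1 42 0 = v ->
  s.1 43 0 = num -> s.1 44 0 = den -> s.1 45 0 = op ->
  d (start a) u < inf ->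
  (u != v -> [/\ adj u v, num <= den, 0 < den & num * len u v <= c * den]) ->
  (op = 1 /\ m = LiesAt (visit_loc u v (num, den)) /\ m' = CarriedBy a \/
   op = 2 /\ m = CarriedBy a /\ m' = LiesAt (visit_loc u v (num, den))) ->
  sched s.2 a (AtVertex (start a)) m e ->
  sched (sem visit s).2 a (AtVertex (start a)) m'
    (spend e a (2 * (d (start a) u + c))).
Proof.
move=> ws h30 h41 h42 h43 h44 h45 hd hmv hop hs.
rewrite /visit 3!sem_block; set s1 := sem (set_var 32 _) _.
have w1 : weighted I Q inf s1 by do 2 apply: weighted_sem => //.
have hh t : weighted I Q inf t -> t.1 30 0 = a -> eval t.1 (home_at (var 30)) = start a.
  move=> wt ht; rewrite -homeE /home -(weighted_input wt) /= ht.
  by rewrite !(weighted_input wt).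
have g31 : s1.1 31 0 = start a by rewrite -(hh s ws h30).
have g32 : s1.1 32 0 = u by rewrite -h41.
have d2 : d u (start a) < inf by rewrite -home_dist_sym.
have hs2 := sem_walk w1 h30 g31 g32 d2 hs.
set s2 := sem walk s1 in hs2 *.
have f2 b j : b \notin 31 :: 32 :: writes walk -> s2.1 b j = s.1 b j.
  rewrite in_cons negb_or in_cons negb_or => /and3P[b31 b32 hb]; rewrite /s2 sem_frame //.
  by rewrite /s1 /= /set_mem /= (negPf b31) (negPf b32).
have w2 : weighted I Q inf s2 by apply: weighted_sem.
rewrite 5!sem_block; set s3 := sem (when _ _) s2; set s4 := sem (emit_list _) s3.
set s5 := sem (when _ _) s4.
have k3 : s3.1 = s2.1 by rewrite /s3 sem_when sem_emit_list; case: ifP.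
have k4 : s4.1 = s2.1 by rewrite /s4 sem_emit_list.
have k5 : s5.1 = s2.1 by rewrite /s5 sem_when sem_emit_list; case: ifP.
have test t : t.1 = s2.1 -> (eval t.1 (neq (var 41) (var 42)) != 0) = (u != v).
  by move=> ->; rewrite -val_eqE /= -h41 -h42 -(f2 41) // -(f2 42) // neqE.
have ev b : b \in [:: 30; 41; 42; 43; 44; 45] -> s2.1 b 0 = s.1 b 0.
  by rewrite !inE => hb; rewrite f2 //; move: hb; do !case/orP; move=> /eqP->.
have f0 : frac_val R (0, 1) = 0%R by rewrite /frac_val mul0r.
have hc : u != v -> (`|frac_val R (num, den) - 0| * (len u v)%:R <= c%:R :> R)%R.
  move=> /hmv[_ h1 h2 h3]; rewrite subr0 /frac_val ger0_norm ?divr_ge0 //=.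
  by rewrite mulrAC ler_pdivrMr ?ltr0n // -!natrM ler_nat.
have hs3 : sched s3.2 a (visit_loc u v (num, den)) m
    (spend e a (d (start a) u + c)).
  rewrite /s3 sem_when test // /visit_loc.
  case: (boolP (u == v)) => nuv; first by apply: schedW hs2 => j; rewrite /spend home_dist_sym; case: ifP => _; lia.
  rewrite (_ : ~~ false = true); last by []. have [h1 h3 h4 h5] := hmv nuv.
  rewrite sem_emit_list; rewrite [map _ _]/=.
  rewrite !ev // h30 h41 h42 h43 h44.
  have hp := sched_move sc (x := (0, 1)) (y := (num, den)) h1 isT isT h3 h4.
  apply: (schedW (e := spend (spend e a (d u (start a))) a c)).
    by move=> j; rewrite /spend home_dist_sym; case: ifP => _; lia.
  apply: hp; first by rewrite f0 hc.
  by rewrite f0 /edge_point eqxx.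
have hs4 : sched s4.2 a (visit_loc u v (num, den)) m'
    (spend e a (d (start a) u + c)).
  rewrite /s4 sem_emit_list k3; rewrite [map _ _]/=; rewrite !ev // h30 h45.
  apply: (schedW (e := spend (spend e a (d (start a) u + c)) a 0)).
    by move=> j; rewrite /spend; case: ifP => _; lia.
  case: hop => [[-> [em ->]]|[-> [em ->]]]; rewrite em in hs3.
    exact: sched_pick.
  exact: sched_drop.
have hs5 : sched s5.2 a (AtVertex u) m'
    (spend e a (d (start a) u + c + c)).
  rewrite /s5 sem_when test //; move: hs4; rewrite /visit_loc.
  case: (boolP (u == v)) => nuv hs4; first by apply: schedW hs4 => j; rewrite /spend; case: ifP => _; lia.
  rewrite (_ : ~~ false = true); last by []. have [h1 h3 h4 h5] := hmv nuv.
  rewrite sem_emit_list k4; rewrite [map _ _]/=.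
  rewrite !ev // h30 h41 h42 h43 h44.
  have hp := sched_move sc (x := (num, den)) (y := (0, 1)) (c := c) h1 h3 h4 isT isT.
  apply: (schedW (e := spend (spend e a (d (start a) u + c)) a c)).
    by move=> j; rewrite /spend; case: ifP => _; lia.
  have -> : AtVertex u = edge_point u v (frac_val R (0, 1)) by rewrite f0 /edge_point eqxx.
  by apply: hp hs4; rewrite f0 distrC hc.
clearbody s5; rewrite 2!sem_block sem_block1; set s6 := sem (set_var 32 _) _.
have w6 : weighted I Q inf s6.
  apply: weighted_sem => //; apply: weighted_sem => //.
  by apply: weighted_eq w2 => b j _; rewrite k5.
have g30 : s6.1 30 0 = a by rewrite /s6 /= /set_mem /= k5 f2.
have g31' : s6.1 31 0 = u by rewrite /s6 /= /set_mem /= k5 f2.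
have g32' : s6.1 32 0 = start a.
  have wx : weighted I Q inf (sem (set_var 31 (var 41)) s5).
    by apply: weighted_sem => //; apply: weighted_eq w2 => b j _; rewrite k5.
  by rewrite -(hh _ wx) // /= /set_mem /= k5 f2.
have := sem_walk w6 g30 g31' g32' hd hs5.
by apply: schedW => j; rewrite /spend; case: ifP => _; lia.
Qed.

End Emission.

(** * Passing the message along the chain *)

Section Chain.
Variables (I : delivery) (Q inf : nat).
Hypothesis sc : scaled I Q inf.
Variable R : realType.
Local Notation n := (nv I).
Local Notation k := (na I).
Local Notation len := (len I Q inf).
Local Notation cap := (cap I Q).
Local Notation d := (d I Q inf).
Local Notation sched := (@sched I Q R).

(* Where agent [i], coming from u, leaves the message on the edge from u to v:
   as far as half its budget allows. *)
Definition drop_num (i u v : nat) : nat :=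
  if len u v <= cap i - d (home I i) u then 1 else cap i - d (home I i) u.
Definition drop_den (i u v : nat) : nat :=
  if len u v <= cap i - d (home I i) u then 1 else len u v.

Lemma sem_prepare_drop s (i j : 'I_k) (u v : 'I_n) :
  measured I Q inf s -> s.1 14 0 = i -> s.1 51 0 = j ->
  s.1 9 (i * k + j) = u -> s.1 10 (i * k + j) = v ->
  let m := (sem prepare_drop s).1 in
  [/\ m 30 0 = i, m 41 0 = u, m 42 0 = v &
    [/\ m 43 0 = drop_num i u v, m 44 0 = drop_den i u v & m 45 0 = 2]].
Proof.
move=> ms h14 h51 h9 h10; have hk : s.1 0 1 = k := weighted_input (measured_weighted ms) 1.
rewrite /prepare_drop 2!sem_block; set s1 := sem (set_var 42 _) _.
have m1 : measured I Q inf s1 by do 2 apply: measured_sem => //.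
have g41 : s1.1 41 0 = u by rewrite /s1 /= /set_mem /= h14 h51 hk h9.
have g42 : s1.1 42 0 = v by rewrite /s1 /= /set_mem /= h14 h51 hk h10.
have g14 : s1.1 14 0 = i by rewrite -h14.
clearbody s1; rewrite 2!sem_block; set s2 := sem (set_var 44 _) _.
have hc : eval s1.1 (cap_at (var 14)) = cap i.
  by rewrite /= g14 (weighted_cap (measured_weighted m1)).
have hd := eval_dist (i := var 14) (v := var 41) m1 g14 g41 (ltn_ord i) (ltn_ord u).
have hn : s1.1 0 0 = n := weighted_input (measured_weighted m1) 0.
have e2 : s2 = (set_mem (set_mem s1.1 43 0 (cap i - d (home I i) u)) 44 0 (len u v), s1.2).
  rewrite /s2 /set_var; cbn [sem eval sub binop_val fst snd]; rewrite hc hd.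
  by rewrite /= /set_mem /= g41 g42 hn (weighted_len (measured_weighted m1)).
clearbody s2; rewrite sem_block sem_when e2.
rewrite [(_, _).1]/= [eval _ _]/= {1 2}/set_mem /= leE /drop_num /drop_den.
by case: ifP => _ /=; rewrite /set_mem /= g14 g41 g42.
Qed.

Lemma leq_cap_inf (i : 'I_k) x : x <= cap i -> x < inf.
Proof. by have := scaled_inf sc (ltn_ord i); lia. Qed.

Lemma leq_len_inf (i j : 'I_k) x y z : x + y + z <= cap i + cap j -> y < inf.
Proof.
by have := scaled_inf sc (ltn_ord i); have := scaled_inf sc (ltn_ord j); lia.
Qed.

Lemma sem_hand_over s (i j : 'I_k) (u v : 'I_n) e :
  measured I Q inf s -> s.1 14 0 = i -> s.1 51 0 = j ->
  s.1 9 (i * k + j) = u -> s.1 10 (i * k + j) = v ->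
  handover I Q inf i j u v ->
  sched s.2 i (AtVertex (start i)) (CarriedBy i) e ->
  sched (sem hand_over s).2 j (AtVertex (start j)) (CarriedBy j)
    (spend (spend e i (2 * cap i)) j (2 * cap j)).
Proof.
move=> ms h14 h51 h9 h10 hh hs; rewrite /hand_over 2!sem_block.
have [g30 g41 g42 [g43 g44 g45]] := sem_prepare_drop ms h14 h51 h9 h10.
set s1 := sem prepare_drop s in g30 g41 g42 g43 g44 g45 *.
have m1 : measured I Q inf s1 by apply: measured_sem.
have o1 : s1.2 = s.2 by apply: sem_silent.
have g51 : s1.1 51 0 = j by rewrite /s1 sem_frame.
clearbody s1; move: hh => /and3P[]; rewrite !homeE => hu hv huv.
have hui := leq_cap_inf hu; have hvj := leq_cap_inf hv.
have hadj : u != v -> adj u v.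
  by move=> huv'; apply: (len_inf (inf := inf) (Q := Q)) => //; apply: leq_len_inf huv.
have hdrop : u != v -> [/\ adj u v, drop_num i u v <= drop_den i u v,
    0 < drop_den i u v &
    drop_num i u v * len u v <= (cap i - d (start i) u) * drop_den i u v].
  move=> /hadj a; rewrite /drop_num /drop_den homeE.
  by case: ifP => h; split=> //; lia.
(* The giver goes as far as it can, so by the third condition of [handover] what is left of the edge
   fits into the receiver's half budget. If the giver crosses the whole edge, nothing is left. *)
have hpick : v != u -> [/\ adj v u, drop_den i u v - drop_num i u v <= drop_den i u v,
    0 < drop_den i u v &
    (drop_den i u v - drop_num i u v) * len v u
      <= (cap j - d (start j) v) * drop_den i u v].
  rewrite eq_sym => /hadj a; rewrite adj_sym (len_sym _ _ (ltn_ord v) (ltn_ord u)).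
  rewrite /drop_num /drop_den homeE.
  case: ifP => h; split=> //; try lia.
  by rewrite leq_mul2r; apply/orP; right; lia.
have eloc : visit_loc R v u (drop_den i u v - drop_num i u v, drop_den i u v) =
    visit_loc R u v (drop_num i u v, drop_den i u v).
  rewrite /visit_loc eq_sym; case: (eqVneq u v) => [->//|nuv].
  have [_ h1 h2 _] := hdrop nuv.
  by rewrite frac_val_opp // edge_point_sym.
have hs1 : sched s1.2 i (AtVertex (start i)) (CarriedBy i) e by rewrite o1.
have := sem_visit sc (measured_weighted m1) g30 g41 g42 g43 g44 g45 _ hdrop
  (or_intror (conj erefl (conj erefl erefl))) hs1.
move=> /(_ hui); rewrite (subnKC hu); set s2 := sem visit s1 => hs2.
have f2 b x : b \notin writes visit -> s2.1 b x = s1.1 b x by apply: sem_frame.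
have m2 : measured I Q inf s2 by apply: measured_sem.
have k41 : s2.1 41 0 = u by rewrite f2.
have k42 : s2.1 42 0 = v by rewrite f2.
have k43 : s2.1 43 0 = drop_num i u v by rewrite f2.
have k44 : s2.1 44 0 = drop_den i u v by rewrite f2.
have k51 : s2.1 51 0 = j by rewrite f2.
clearbody s2; rewrite sem_block sem_block1; set s3 := sem prepare_pick s2.
have m3 : measured I Q inf s3 by apply: measured_sem.
have o3 : s3.2 = s2.2 by apply: sem_silent.
have s3E b : s3.1 b 0 = (sem (set_var 30 (var 51)) (sem (set_var 45 (Cst 1))
    (sem (set_var 42 (var 46)) (sem (set_var 41 (var 42))
    (sem (set_var 46 (var 41)) (sem (set_var 43 (sub (var 44) (var 43))) s2)))))).1 b 0.
  by rewrite /s3 /prepare_pick 5!sem_block sem_block1.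
clearbody s3.
have l30 : s3.1 30 0 = j by rewrite s3E !(sem_set_var, eval_var, eval_sub).
have l41 : s3.1 41 0 = v by rewrite s3E !(sem_set_var, eval_var, eval_sub).
have l42 : s3.1 42 0 = u by rewrite s3E !(sem_set_var, eval_var, eval_sub).
have l43 : s3.1 43 0 = drop_den i u v - drop_num i u v.
  by rewrite s3E !(sem_set_var, eval_var, eval_sub) k43 k44.
have l44 : s3.1 44 0 = drop_den i u v by rewrite s3E !(sem_set_var, eval_var, eval_sub).
have l45 : s3.1 45 0 = 1 by rewrite s3E !(sem_set_var, eval_var, eval_sub).
rewrite -o3 -eloc in hs2.
have := sem_visit sc (measured_weighted m3) l30 l41 l42 l43 l44 l45 _ hpick
  (or_introl (conj erefl (conj erefl erefl))) (sched_switch j hs2).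
move=> h; have {}h := h hvj; rewrite (subnKC hv) in h.
exact: h.
Qed.

Lemma sem_visit_vertex s (c : 'I_k) (v : 'I_n) ve op m m' e :
  measured I Q inf s -> s.1 14 0 = c ->
  (forall t, measured I Q inf t -> eval t.1 ve = v) ->
  d (start c) v <= cap c ->
  (op = 1 /\ m = LiesAt (AtVertex v) /\ m' = CarriedBy c \/
   op = 2 /\ m = CarriedBy c /\ m' = LiesAt (AtVertex v)) ->
  sched s.2 c (AtVertex (start c)) m e ->
  sched (sem (visit_vertex ve op) s).2 c (AtVertex (start c)) m'
    (spend e c (2 * cap c)).
Proof.
move=> ms h14 hv hd hop hs; rewrite /visit_vertex 2!sem_block.
set s1 := sem (set_var 41 _) _.
have m1 : measured I Q inf s1 by do 2 apply: measured_sem => //.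
have g30 : s1.1 30 0 = c by rewrite /s1 /= /set_mem /= h14.
have g41 : s1.1 41 0 = v by rewrite /s1 sem_set_var hv //; apply: measured_sem.
have o1 : s1.2 = s.2 by [].
clearbody s1; rewrite 2!sem_block; set s2 := sem (set_var 45 _) _.
have m2 : measured I Q inf s2 by do 2 apply: measured_sem => //.
have k30 : s2.1 30 0 = c by [].
have k41 : s2.1 41 0 = v by [].
have k42 : s2.1 42 0 = v by rewrite /s2 /= /set_mem /= hv.
have k45 : s2.1 45 0 = op by rewrite /s2 /= /set_mem /=.
have o2 : s2.2 = s.2 by rewrite -o1.
clearbody s2; rewrite sem_block1.
(* Variables 43 and 44 hold leftovers here; with equal ends the fraction is ignored. *)
have hl : visit_loc R v v (s2.1 43 0, s2.1 44 0) = AtVertex v by rewrite /visit_loc eqxx.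
have hvv : v != v -> [/\ adj v v, s2.1 43 0 <= s2.1 44 0, 0 < s2.1 44 0 &
    s2.1 43 0 * len v v <= 0 * s2.1 44 0] by rewrite eqxx.
rewrite -hl in hop; rewrite -o2 in hs.
have := sem_visit sc (measured_weighted m2) k30 k41 k42 erefl erefl k45 _ hvv hop hs.
move=> /(_ (leq_cap_inf hd)); apply: schedW => x; rewrite /spend addn0.
by case: ifP => _; rewrite ?leq_add2l ?leq_mul2l ?hd.
Qed.

Section Links.
Variables lw hu hv : nat -> nat -> nat.
Hypothesis links_ok : forall i j, i < k -> j < k ->
  link_ok I Q inf i j (lw i j) (hu i j) (hv i j).

Definition last_cost (i : nat) : nat :=
  if d (home I i) (tgt I) <= cap i then 0 else 1.

(* 0 when the agents reachable from [i] with [r] links include one that can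
   reach the target. *)
Definition reach (r i : nat) : nat := bf lw k last_cost r i.

Record ready (s : config) : Prop := Ready {
  ready_measured : measured I Q inf s;
  ready_u : forall i j, i < k -> j < k -> s.1 9 (i * k + j) = hu i j;
  ready_v : forall i j, i < k -> j < k -> s.1 10 (i * k + j) = hv i j;
  ready_next : forall r i, r < k -> i < k -> let x := s.1 12 (r.+1 * k + i) in
    x = i /\ reach r.+1 i = reach r i \/
    [/\ x < k, reach r.+1 i = lw i x + reach r x & reach r.+1 i < reach r i]
}.

Lemma ready_eq s s' :
  (forall a j, a \in [:: 0; 2; 3; 4; 7; 9; 10; 12] -> s'.1 a j = s.1 a j) ->
  ready s -> ready s'.
Proof.
move=> h [h1 h2 h3 h4]; split.
- apply: measured_eq h1 => a j ha; apply: h; move: ha.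
  by rewrite !inE => /or4P[||| /orP[]] ->; rewrite ?orbT.
- by move=> i j hi hj; rewrite h ?h2.
- by move=> i j hi hj; rewrite h ?h3.
- by move=> r i hr hi; rewrite h //; apply: h4.
Qed.

Lemma ready_sem p s :
  all (fun a => a \notin writes p) [:: 0; 2; 3; 4; 7; 9; 10; 12] ->
  ready s -> ready (sem p s).
Proof. by move=> /allP h; apply: ready_eq => a j /h; apply: sem_frame. Qed.

Lemma sem_chain s (c0 : 'I_k) :
  ready s -> s.1 14 0 = c0 -> d (start c0) (src I) <= cap c0 ->
  reach k c0 = 0 -> s.2 = [:: 1] ->
  exists acts : seq (action n k (nat * nat)),
     [/\ (sem chain s).2 = 1 :: encode_schedule acts, all (@positive_dens _ _) acts &
         feasible (fun i => 2%:R * ratr (budget i))%R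
           (map (map_action (@frac_val R)) acts)].
Proof.
move=> rs h14 hsrc hreach hout; rewrite /chain sem_block.
have hsrcE t : measured I Q inf t -> eval t.1 (inp 2) = src I.
  by move=> mt; rewrite /= (weighted_input (measured_weighted mt)).
have htgtE t : measured I Q inf t -> eval t.1 (inp 3) = tgt I.
  by move=> mt; rewrite /= (weighted_input (measured_weighted mt)).
have hs0 : sched s.2 c0 (AtVertex (start c0)) (LiesAt (AtVertex (src I))) (fun=> 0).
  by rewrite hout; apply: sched_nil.
have hs1 := sem_visit_vertex (ready_measured rs) h14 hsrcE hsrc
  (or_introl (conj erefl (conj erefl erefl))) hs0.
set s1 := sem (visit_vertex _ _) s in hs1 *.
have r1 : ready s1 by apply: ready_sem.
have k14 : s1.1 14 0 = c0 by rewrite /s1 sem_frame.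
clearbody s1; rewrite sem_block sem_block1; set p := PFor 50 1 _.
pose Inv y (s' : config) := exists (c : 'I_k) (e : 'I_k -> nat),
  [/\ s'.1 14 0 = c, reach (k - y) c = 0,
      sched s'.2 c (AtVertex (start c)) (CarriedBy c) e,
      forall j : 'I_k, j != c -> e j <= 4 * cap j /\ (e j = 0 \/ 0 < reach (k - y) j) &
      e c <= 2 * cap c].
have hk t : ready t -> t.1 0 1 = k.
  by move=> rt; apply: weighted_input (measured_weighted (ready_measured rt)) 1.
suff [c [e [j14 jr js je jc]]] : Inv k (sem p s1).
  have rp : ready (sem p s1) by apply: ready_sem.
  set s2 := sem p s1 in j14 js rp *; clearbody s2.
  have htgt : d (start c) (tgt I) <= cap c.
    by move: jr; rewrite subnn /reach /= /last_cost homeE; case: ifP.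
  have hs2 := sem_visit_vertex (ready_measured rp) j14 htgtE htgt
    (or_intror (conj erefl (conj erefl erefl))) js.
  apply: (sched_feasible sc hs2) => j; rewrite /spend.
  case: (eqVneq j c) => [->|nj]; first by lia.
  by have [] := je j nj; lia.
apply: (sem_forN (Inv := Inv)) => //; first exact: hk.
  exists c0, (spend (fun=> 0) c0 (2 * cap c0)); rewrite subn0.
  split; [by rewrite set_counterE k14|exact: hreach|exact: hs1| |].
    by move=> j /negPf nj; rewrite /spend nj; split; [|left].
  by rewrite /spend eqxx add0n.
move=> y s2 hy h50 fr2 [c [e [j14 jr js je jc]]].
have r2 : ready s2.
  apply: ready_eq r1 => a j ha; apply: fr2.
  by move: ha; rewrite !inE => ha; repeat (case/orP: ha => [/eqP->|ha] //); move/eqP: ha => ->.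
set r := k - y.+1; have er : k - y = r.+1 by rewrite /r; lia.
have rk : r < k by rewrite /r; lia.
rewrite er in jr je.
have hx := ready_next r2 rk (ltn_ord c); cbv zeta in hx.
set x := s2.1 12 _ in hx.
rewrite sem_block; set s3 := sem (set_var 51 _) s2.
have g51 : s3.1 51 0 = x.
  by rewrite /s3 sem_set_var /= h50 (hk _ r2) er j14.
have g14 : s3.1 14 0 = c by rewrite /s3 sem_set_var.
have o3 : s3.2 = s2.2 by [].
have r3 : ready s3 by apply: ready_sem.
clearbody s3; rewrite sem_block1 sem_when.
have -> : (eval s3.1 (neq (var 51) (var 14)) != 0) = (x != c).
  by rewrite /= g51 g14 neqE.
case: (boolP (x == c :> nat)) => [/eqP exc|nxc].
  rewrite (_ : ~~ true = false); last by [].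
  have err : reach r.+1 c = reach r c.
    case: hx => [[_ ->]//|[_ h1 h2]]; move: h1 h2; rewrite exc => h1 h2.
    by rewrite h1 -[X in X < _]h1 ltnNge h1 leq_addl in h2 *.
  exists c, e; rewrite -/r -err; rewrite -o3 in js.
  split; [by rewrite set_counterE g14|exact: jr|exact: js| |exact: jc].
  move=> i ni; have [h1 h2] := je i ni; split=> //; case: h2 => [|h2]; [by left|right].
  by apply: leq_trans h2 _; apply: bfS_leq.
rewrite (_ : ~~ false = true); last by [].
case: hx => [[exc _]|[xk hf hlt]]; first by rewrite exc eqxx in nxc.
have lw0 : lw c x = 0 by lia.
have rx0 : reach r x = 0 by lia.
pose x' := Ordinal xk.
have nx' : x' != c by rewrite -val_eqE.
case: (links_ok (ltn_ord c) xk) => [[_ un vn hh]|[e1 _]]; last by rewrite e1 in lw0.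
pose u := Ordinal un; pose v := Ordinal vn.
have hu' : s3.1 9 (c * k + x') = u by rewrite (ready_u r3).
have hv' : s3.1 10 (c * k + x') = v by rewrite (ready_v r3).
rewrite -o3 in js.
have js3 := sem_hand_over (j := x') (ready_measured r3) g14 g51 hu' hv' hh js.
have h51 : (sem hand_over s3).1 51 0 = x by rewrite sem_frame.
set s4 := sem hand_over s3 in js3 h51 *.
rewrite sem_block sem_block1 -/s4; clearbody s4.
(* The next carrier has [reach] 0 in the lower row, hence also in the current one, so the invariant
   says that it has spent nothing. *)
have ex0 : e x' = 0.
  have [_ [//|h]] := je x' nx'.
  by have := bfS_leq lw k last_cost r x'; rewrite -/(reach r x') rx0 leqn0 -/(reach _ _); lia.
exists x', (spend (spend e c (2 * cap c)) x' (2 * cap x')); split.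
- by rewrite set_counterE sem_set_var eval_var h51.
- exact: rx0.
- exact: js3.
- move=> i ni; rewrite /spend (negPf ni) addn0 -/r; case: (eqVneq i c) => [->|nic].
    (* The old carrier is retired: the strictness of the hop gives it positive [reach] in the new
       row. *)
    by split; [lia|right; apply: leq_ltn_trans hlt].
  have [h1 h2] := je i nic; rewrite addn0; split=> //.
  case: h2 => [|h2]; [by left|right].
  by apply: leq_trans h2 _; apply: bfS_leq.
by rewrite /spend eqxx (negPf nx') ex0 !addn0.
Qed.

End Links.
End Chain.

(** * The whole program and its correctness *)

Definition prepare : prog :=
  block [:: common_den; caps; lens; distances; links; last_agents;
            bellman true; find_first].

Definition delivery_prog : prog :=
  block [:: prepare;
            PIf (var 13) (block [:: PEmit (Cst 1); chain]) (PEmit (Cst 0))].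

Section Prepare.
Variable I : delivery.
Local Notation n := (nv I).
Local Notation k := (na I).

Section Measured.
Variables Q inf : nat.
Local Notation cap := (cap I Q).
Local Notation d := (d I Q inf).

Lemma measured_cap s i j : measured I Q inf s -> eval s.1 i = j -> j < k ->
  eval s.1 (cap_at i) = cap j.
Proof. by move=> ms hi hj; rewrite /= hi (weighted_cap (measured_weighted ms)). Qed.

Lemma sem_last_agents s i : measured I Q inf s -> i < k ->
  (sem last_agents s).1 11 i = last_cost I Q inf i.
Proof.
move=> ms; have hk := weighted_input (measured_weighted ms) 1.
have ht : input_nth I 3 < n by rewrite input_tgt.
pose Inv a (s' : config) := forall i, i < a -> s'.1 11 i = last_cost I Q inf i.
suff h : Inv k (sem last_agents s) by apply: h.
apply: (sem_forN (Inv := Inv)) => //.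
move=> a s' ha h20 fr hI j.
have ms' : measured I Q inf s'.
  by apply: measured_eq ms => b x; rewrite !inE => hb; apply: fr; case/or4P: hb => [||| /orP[]] /eqP->.
have hd := eval_dist ms' (h20 : eval s'.1 (var 20) = a)
  (weighted_input (measured_weighted ms') 3 : eval s'.1 (inp 3) = _) ha ht.
have hc := measured_cap ms' (h20 : eval s'.1 (var 20) = a) ha.
rewrite /le; cbn [sem eval sub binop_val]; rewrite hd hc leE.
rewrite ltnS leq_eqVlt /last_cost -input_tgt => /orP[/eqP->|hj].
  by case: ifP => h; rewrite /= /set_mem /= h20 eqxx.
rewrite -/(last_cost I Q inf j) -(hI j hj) /=.
by case: ifP => h; rewrite /= /set_mem /= h20 (ltn_eqF hj).
Qed.

Lemma sem_find_first s (f : nat -> nat) : measured I Q inf s ->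
  (forall i, i < k -> s.1 11 (k * k + i) = f i) ->
  let m := (sem find_first s).1 in
  m 13 0 = 0 /\ (forall i, i < k -> d (home I i) (src I) <= cap i -> f i != 0) \/
  m 13 0 = 1 /\ [/\ m 14 0 < k, d (home I (m 14 0)) (src I) <= cap (m 14 0) &
                    f (m 14 0) = 0].
Proof.
move=> ms hf; rewrite /find_first sem_block sem_block1; set s1 := sem (set_var 13 _) s.
have m1 : measured I Q inf s1 by apply: measured_sem.
have hf1 i : i < k -> s1.1 11 (k * k + i) = f i by move=> hi; rewrite -hf.
have h13 : s1.1 13 0 = 0 by [].
clearbody s1; have hk := weighted_input (measured_weighted m1) 1.
have hsrc : input_nth I 2 < n by rewrite input_src.
set p := PFor 20 1 _.
pose Inv a (s' : config) :=
  s'.1 13 0 = 0 /\ (forall i, i < a -> d (home I i) (src I) <= cap i -> f i != 0) \/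
  s'.1 13 0 = 1 /\ [/\ s'.1 14 0 < k,
    d (home I (s'.1 14 0)) (src I) <= cap (s'.1 14 0) & f (s'.1 14 0) = 0].
suff h : Inv k (sem p s1) by apply: h.
apply: (sem_forN (Inv := Inv)) => //; first by left; split.
move=> a s2 ha h20 fr hI.
have m2 : measured I Q inf s2.
  by apply: measured_eq m1 => b x; rewrite !inE => hb; apply: fr; case/or4P: hb => [||| /orP[]] /eqP->.
have hd := eval_dist m2 (h20 : eval s2.1 (var 20) = a)
  (weighted_input (measured_weighted m2) 2 : eval s2.1 (inp 2) = _) ha hsrc.
have hc := measured_cap m2 (h20 : eval s2.1 (var 20) = a) ha.
have hk2 : s2.1 0 1 = k := weighted_input (measured_weighted m2) 1.
have ef : eval s2.1 (Get 11 (cell 1 (inp 1) (var 20))) = f a.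
  by rewrite /= hk2 h20 fr // hf1.
rewrite /le !sem_when; cbn [eval sub binop_val]; rewrite hd hc leE input_src.
rewrite -/(eval s2.1 (Get 11 (cell 1 (inp 1) (var 20)))) ef leE leqn0.
case: ifP => [h1|h1]; first case: eqP => [h2|/eqP h2].
- by right; rewrite /= /set_mem /= h20.
- case: hI => [[g1 g2]|]; [left; split=> // i|by right].
  by rewrite ltnS leq_eqVlt => /orP[/eqP->|/g2].
case: hI => [[g1 g2]|]; [left; split=> // i|by right].
by rewrite ltnS leq_eqVlt => /orP[/eqP->|/g2//]; rewrite h1.
Qed.

End Measured.

Lemma sem_prepare s : reads_input I s ->
  exists Q inf lw hu hv,
  [/\ scaled I Q inf,
      forall i j, i < k -> j < k ->
        link_ok I Q inf i j (lw i j) (hu i j) (hv i j),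
      ready I Q inf lw hu hv (sem prepare s) &
      let m := (sem prepare s).1 in
      m 13 0 = 0 /\ (forall i, i < k -> d I Q inf (home I i) (src I) <= cap I Q i ->
        reach I Q inf lw k i != 0) \/
      m 13 0 = 1 /\ [/\ m 14 0 < k,
        d I Q inf (home I (m 14 0)) (src I) <= cap I Q (m 14 0) &
        reach I Q inf lw k (m 14 0) = 0]].
Proof.
move=> rs; rewrite /prepare sem_block.
have := sem_common_den rs; have r1 := reads_input_sem (p := common_den) isT rs.
set s1 := sem common_den s in r1 *; set Q := s1.1 1 0 => -[Q0 dW dB].
have hQ : s1.1 1 0 = Q by [].
clearbody Q; clearbody s1; rewrite sem_block.
have hcap := sem_caps r1 hQ; have r2 := reads_input_sem (p := caps) isT r1.
have hQ2 : (sem caps s1).1 1 0 = Q by rewrite sem_frame.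
set s2 := sem caps s1 in hcap r2 hQ2 *; clearbody s2; cbv zeta in hcap.
have [inf hinf] : exists inf, s2.1 2 0 = inf by exists (s2.1 2 0).
rewrite hinf in hcap.
have sc : scaled I Q inf by split=> // i hi; have [] := hcap i hi.
rewrite sem_block; have hlen := sem_lens r2 hQ2 hinf.
have w3 : weighted I Q inf (sem lens s2).
  split=> //; first exact: reads_input_sem.
    by rewrite sem_frame.
  by move=> i hi; rewrite sem_frame //; have [] := hcap i hi.
set s3 := sem lens s2 in w3 *; clearbody s3; rewrite sem_block.
have m4 : measured I Q inf (sem distances s3).
  by split; [apply: weighted_sem|apply: sem_distances].
set s4 := sem distances s3 in m4 *; clearbody s4; rewrite sem_block.
have m5 : measured I Q inf (sem links s4) by apply: measured_sem.
have hl := sem_links m4.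
set s5 := sem links s4 in m5 hl *; clearbody s5; cbv zeta in hl.
pose lw i j := s5.1 8 (i * k + j); pose hu i j := s5.1 9 (i * k + j).
pose hv i j := s5.1 10 (i * k + j).
exists Q, inf, lw, hu, hv; rewrite sem_block.
have m6 : measured I Q inf (sem last_agents s5) by apply: measured_sem.
have hlast i := sem_last_agents m5 (i := i).
have f6 a j : a \notin [:: 20; 11] -> (sem last_agents s5).1 a j = s5.1 a j.
  by move=> ha; rewrite sem_frame //; apply: contra ha; rewrite /= !inE => /or3P[] ->; rewrite ?orbT.
set s6 := sem last_agents s5 in m6 hlast f6 *; clearbody s6; rewrite sem_block.
have hk6 : s6.1 0 1 = k := weighted_input (measured_weighted m6) 1.
have hw6 v u : v < k -> u < k -> s6.1 8 (v * k + u) = lw v u by rewrite f6.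
have [hF hX] := sem_bellman (o := true) hk6 hw6 hlast.
have r7 : ready I Q inf lw hu hv (sem (bellman true) s6).
  split; first by apply: measured_sem.
  - by move=> i j _ _; rewrite sem_frame // f6.
  - by move=> i j _ _; rewrite sem_frame // f6.
  - exact: hX.
set s7 := sem (bellman true) s6 in hF r7 *; clearbody s7; rewrite sem_block1.
split=> //; first by apply: ready_sem.
apply: (sem_find_first (f := reach I Q inf lw k) (ready_measured r7)) => i hi.
exact: hF.
Qed.

Lemma delivery_correct (R : realType) :
  correct_output (2%:R : R)%R I
    (sem delivery_prog (load (encode_instance I), [::])).2.
Proof.
have rs : reads_input I (load (encode_instance I), [::]) by [].
rewrite /delivery_prog sem_block sem_block1.
have [Q [inf [lw [hu [hv [sc hl rp hres]]]]]] := sem_prepare rs.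
have ho : (sem prepare (load (encode_instance I), [::])).2 = [::] by rewrite sem_silent.
set s := sem prepare _ in rp hres ho *; clearbody s; cbv zeta in hres.
rewrite [sem _ _](_ : _ = if s.1 13 0 != 0 then sem (block [:: PEmit (Cst 1); chain]) s
   else (s.1, rcons s.2 0)); last by [].
case: hres => [[-> hno]|[-> [ck hsrc hr]]].
  rewrite eqxx /= ho; left; split=> //; case=> acts hf.
  (* Closed under links by contraposition: a value 0 would pass back along a link of cost 0.
     Stability after [k] rounds keeps this within the same row. *)
  pose K (i : 'I_k) := reach I Q inf lw k i != 0.
  have [||i Ki hi] := feasible_chain sc (K := K) hf.
  - by move=> i hi; apply: hno; rewrite ?homeE.
  - move=> i j Ki lij; apply: contra Ki => /eqP rj.
    have lw0 : lw i j = 0 by case: (hl i j (ltn_ord i) (ltn_ord j)) => [[]|[]].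
    have := bf_edge lw (last_cost I Q inf) (ltn_ord i) (ltn_ord j).
    by rewrite -!/(reach I Q inf lw k _) rj lw0 leqn0.
  (* An agent that can reach t has value 0 in row 0, hence in row [k], so it cannot belong to
     [K]. *)
  have := bf_leq lw k (last_cost I Q inf) i (leq0n k).
  rewrite [bf _ _ _ 0 _]/= {2}/last_cost homeE hi leqn0.
  by rewrite -/(reach I Q inf lw k i) (negPf Ki).
rewrite [_ != _]/=; right; rewrite sem_block sem_block1; set s' := sem (PEmit _) s.
have r' : ready I Q inf lw hu hv s' by apply: ready_eq rp.
have h14 : s'.1 14 0 = Ordinal ck by [].
have o' : s'.2 = [:: 1] by rewrite /s' /= ho.
apply: (sem_chain sc R hl r' h14) => //.
by rewrite -homeE.
Qed.

(** The loop bounds are written in binary, but the encoding lists the whole matrix and all agents,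
    so its length dominates them. The existence of s makes the number of vertices positive, hence at
    most its square. *)
Lemma delivery_size : 0 < bitsize (encode_instance I) /\
  (n <= bitsize (encode_instance I) /\ k <= bitsize (encode_instance I)).
Proof.
have := size_bitsize (encode_instance I); rewrite size_encode_instance.
have := leq_pmull n (leq_ltn_trans (leq0n _) (ltn_ord (src I))); lia.
Qed.

End Prepare.

Local Open Scope ring_scope.

Theorem theorem2 :
  exists A : cmd,
    forall R : realType, resource_augmented_algorithm (2%:R : R) A.
Proof.
exists (compile delivery_prog) => R.
have [a [e h]] := compile_polynomial (p := delivery_prog) isT.
have hrun I := h (encode_instance I) (delivery_size I).1
  (delivery_size I).2.1 (delivery_size I).2.2.
split.
  exists a, 0%N, e => I; have [T [hT lT]] := hrun I.
  by exists (sem delivery_prog (load (encode_instance I), [::])).2, T; rewrite addn0.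
move=> I; have [T [hT _]] := hrun I.
exists (sem delivery_prog (load (encode_instance I), [::])).2, T; split=> //.
exact: delivery_correct.
Qed.
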